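(* Let $L$ be the free Lie algebra over $\mathbb{C}$ on generators $a,b,c$, with $\mathfrak{sl}_3(\mathbb{C})$ acting on $L$ by derivations extending the natural representation on $L_1=\mathrm{span}\{a,b,c\}$. Then the space of Lie invariants of degree 9 (a subspace of $L_9$) has dimension 4 and the following basis $I_9^{(1)},\dots,I_9^{(4)}$: $$\begin{aligned} I_9^{(1)} &= [[[[ba]a][cb]][[cb][ca]]] - [[[[ba]b][ca]][[cb][ca]]] + [[[[ba]c][ba]][[cb][ca]]] \\ &\quad - [[[[ba]c][cb]][[ca][ba]]] - [[[[ca]a][cb]][[cb][ba]]] + [[[[ca]b][ca]][[cb][ba]]] \\ &\quad + [[[[ca]b][cb]][[ca][ba]]] - [[[[ca]c][ba]][[cb][ba]]] - [[[[cb]b][ca]][[ca][ba]]] \\ &\quad + [[[[cb]c][ba]][[ca][ba]]], \end{aligned}$$ $$\begin{aligned} I_9^{(2)} &= [[[[ca][ba]][ba]][[cb]c]] - [[[[ca][ba]][ca]][[cb]b]] - 2[[[[ca][ba]][cb]][[ba]c]] \\ &\quad + [[[[ca][ba]][cb]][[ca]b]] - [[[[cb][ba]][ba]][[ca]c]] + [[[[cb][ba]][ca]][[ba]c]] \\ &\quad + [[[[cb][ba]][ca]][[ca]b]] - [[[[cb][ba]][cb]][[ca]a]] - [[[[cb][ca]][ca]][[ba]b]] \\ &\quad + [[[[cb][ca]][cb]][[ba]a]], \end{aligned}$$ $$\begin{aligned} I_9^{(3)} &= [[[[ca][ba]][ba]][[cb]c]] - [[[[ca][ba]][ca]][[cb]b]]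 + [[[[ca][ba]][cb]][[ba]c]] \\ &\quad - 2[[[[ca][ba]][cb]][[ca]b]] - [[[[cb][ba]][ba]][[ca]c]] - [[[[cb][ba]][ca]][[ba]c]] \\ &\quad + 2[[[[cb][ba]][ca]][[ca]b]] + [[[[cb][ba]][cb]][[ca]a]] - [[[[[ba]a]a][cb]][[cb]c]] \\ &\quad + [[[[[ba]a]b][ca]][[cb]c]] + [[[[[ba]a]b][cb]][[ca]c]] - [[[[[ba]a]c][ba]][[cb]c]] \\ &\quad - 2[[[[[ba]a]c][cb]][[ba]c]] + [[[[[ba]a]c][cb]][[ca]b]] - [[[[[ba]b]b][ca]][[ca]c]] \\ &\quad + [[[[[ba]b]c][ba]][[ca]c]] + 2[[[[[ba]b]c][ca]][[ba]c]] - [[[[[ba]b]c][ca]][[ca]b]] \\ &\quad - [[[[[ba]b]c][cb]][[ca]a]] - 2[[[[[ba]c]c][ba]][[ba]c]] + [[[[[ba]c]c][ba]][[ca]b]] \\ &\quad + [[[[[ba]c]c][cb]][[ba]a]] + [[[[[ca]a]a][cb]][[cb]b]] - [[[[[ca]a]b][ca]][[cb]b]] \\ &\quad + [[[[[ca]a]b][cb]][[ba]c]] - 2[[[[[ca]a]b][cb]][[ca]b]] + [[[[[ca]a]c][ba]][[cb]b]] \\ &\quad + [[[[[ca]a]c][cb]][[ba]b]] - [[[[[ca]b]b][ca]][[ba]c]] + 2[[[[[ca]b]b][ca]][[ca]b]] \\ &\quad + [[[[[ca]b]b][cb]][[ca]a]] + [[[[[ca]b]c][ba]][[ba]c]] -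 2[[[[[ca]b]c][ba]][[ca]b]] \\ &\quad - [[[[[ca]b]c][ca]][[ba]b]] - [[[[[ca]b]c][cb]][[ba]a]] + [[[[[ca]c]c][ba]][[ba]b]] \\ &\quad - [[[[[cb]b]b][ca]][[ca]a]] + [[[[[cb]b]c][ba]][[ca]a]] + [[[[[cb]b]c][ca]][[ba]a]] \\ &\quad - [[[[[cb]c]c][ba]][[ba]a]], \end{aligned}$$ $$\begin{aligned} I_9^{(4)} &= [[[[ba]a][ba]][[[cb]c]c]] - [[[[ba]a][ca]][[[cb]b]c]] - [[[[ba]a][cb]][[[ba]c]c]] \\ &\quad + [[[[ba]a][cb]][[[ca]b]c]] - [[[[ba]b][ba]][[[ca]c]c]] + [[[[ba]b][ca]][[[ca]b]c]] \\ &\quad - [[[[ba]b][cb]][[[ca]a]c]] - [[[[ba]c][ba]][[cb][ca]]] + 2[[[[ba]c][ba]][[[ba]c]c]] \\ &\quad - [[[[ba]c][ba]][[[ca]b]c]] + 2[[[[ba]c][ca]][[cb][ba]]] - 2[[[[ba]c][ca]][[[ba]b]c]] \\ &\quad + [[[[ba]c][ca]][[[ca]b]b]] - 2[[[[ba]c][cb]][[ca][ba]]] + 2[[[[ba]c][cb]][[[ba]a]c]] \\ &\quad - [[[[ba]c][cb]][[[ca]a]b]] - [[[[ca]a][ba]][[[cb]b]c]] + [[[[ca]a][ca]][[[cb]b]b]] \\ &\quad - [[[[ca]a][cb]][[cb][ba]]] + [[[[ca]a][cb]][[[ba]b]c]] - [[[[ca]a][cb]][[[ca]b]b]] \\ &\quad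 - [[[[ca]b][ba]][[[ba]c]c]] + 2[[[[ca]b][ba]][[[ca]b]c]] - 2[[[[ca]b][ca]][[cb][ba]]] \\ &\quad + [[[[ca]b][ca]][[[ba]b]c]] - 2[[[[ca]b][ca]][[[ca]b]b]] + 2[[[[ca]b][cb]][[ca][ba]]] \\ &\quad - [[[[ca]b][cb]][[[ba]a]c]] + 2[[[[ca]b][cb]][[[ca]a]b]] + [[[[ca]c][ba]][[cb][ba]]] \\ &\quad - [[[[ca]c][ba]][[[ba]b]c]] + [[[[ca]c][ca]][[[ba]b]b]] - [[[[ca]c][cb]][[[ba]a]b]] \\ &\quad - [[[[cb]b][ba]][[[ca]a]c]] + [[[[cb]b][ca]][[ca][ba]]] + [[[[cb]b][ca]][[[ca]a]b]] \\ &\quad - [[[[cb]b][cb]][[[ca]a]a]] - [[[[cb]c][ba]][[ca][ba]]] + [[[[cb]c][ba]][[[ba]a]c]] \\ &\quad - [[[[cb]c][ca]][[[ba]a]b]] + [[[[cb]c][cb]][[[ba]a]a]]. \end{aligned}$$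
   Context: $L=\bigoplus_{n\ge1}L_n$ is the grading of the free Lie algebra by degree (each generator has degree 1). The space $L_1$ is regarded as the natural representation of $\mathfrak{sl}_3(\mathbb{C})$ (the trace-zero $3\times3$ complex matrices acting on column vectors by matrix-vector multiplication) by identifying $a,b,c$ with the standard basis column vectors $(1,0,0)^t,(0,1,0)^t,(0,0,1)^t$ respectively. The action extends to all of $L$ by the derivation rule $D.[t,u]=[D.t,u]+[t,D.u]$ for $D\in\mathfrak{sl}_3(\mathbb{C})$. A Lie invariant of degree $j$ is an element $Z\in L_j$ with $D.Z=0$ for all $D\in\mathfrak{sl}_3(\mathbb{C})$. Commas are omitted in Lie brackets: $[uv]$ means $[u,v]$; e.g. $[[[ba]b][cb]]=[[[b,a],b],[c,b]]$. *)

(* Defs.v *)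
From HB Require Import structures.
From mathcomp Require Import all_boot all_order all_algebra.
From mathcomp Require Import generic_quotient boolp reals complex.

Set Implicit Arguments.
Unset Strict Implicit.
Unset Printing Implicit Defensive.

Import GRing.Theory.
Local Open Scope ring_scope.
Local Open Scope quotient_scope.

Reserved Notation "⟦ u , v ⟧" (at level 0, u, v at level 99,
  format "⟦ u ,  v ⟧").

HB.mixin Record Lmodule_isLieAlgebra (K : comNzRingType) L
    of GRing.Lmodule K L := {
  lie_bracket : L -> L -> L;
  lie_linearl : forall k u v w,
    lie_bracket (k *: u + v) w = k *: lie_bracket u w + lie_bracket v w;
  lie_linearr : forall k u v w,
    lie_bracket u (k *: v + w) = k *: lie_bracket u v + lie_bracket u w;
  lie_alternating : forall u, lie_bracket u u = 0;
  lie_jacobi : forall u v w,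
    lie_bracket u (lie_bracket v w) + lie_bracket v (lie_bracket w u)
      + lie_bracket w (lie_bracket u v) = 0
}.

#[short(type="lieAlgType")]
HB.structure Definition LieAlgebra (K : comNzRingType) :=
  {L of Lmodule_isLieAlgebra K L & GRing.Lmodule K L}.

Notation "⟦ u , v ⟧" := (lie_bracket u v) : ring_scope.

Definition lie_morphism (K : comNzRingType) (L M : lieAlgType K) (f : L -> M) :=
  linear f /\ forall u v, f ⟦u, v⟧ = ⟦f u, f v⟧.

Definition lie_derivation (K : comNzRingType) (L : lieAlgType K) (d : L -> L) :=
  linear d /\ forall u v, d ⟦u, v⟧ = ⟦d u, v⟧ + ⟦u, d v⟧.

(* The free Lie algebra on X over K is the quotient of the formal expressions *)
(* below by the smallest congruence containing the Lie algebra axioms.        *)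
Inductive lie_term (K X : Type) : Type :=
| TGen of X
| TZero
| TAdd of lie_term K X & lie_term K X
| TScale of K & lie_term K X
| TBracket of lie_term K X & lie_term K X.

Arguments TGen {K X}.
Arguments TZero {K X}.

Section TermChoice.
Variables K X : choiceType.

Fixpoint lie_term_encode (t : lie_term K X) : GenTree.tree (K + X) :=
  match t with
  | TGen x => GenTree.Leaf (inr x)
  | TZero => GenTree.Node 0 [::]
  | TAdd s t => GenTree.Node 1 [:: lie_term_encode s; lie_term_encode t]
  | TScale k t => GenTree.Node 2 [:: GenTree.Leaf (inl k); lie_term_encode t]
  | TBracket s t => GenTree.Node 3 [:: lie_term_encode s; lie_term_encode t]
  end.

Fixpoint lie_term_decode (t : GenTree.tree (K + X)) : lie_term K X :=
  match t with
  | GenTree.Leaf (inr x) => TGen x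
  | GenTree.Node 1 [:: s; t] => TAdd (lie_term_decode s) (lie_term_decode t)
  | GenTree.Node 2 [:: GenTree.Leaf (inl k); t] => TScale k (lie_term_decode t)
  | GenTree.Node 3 [:: s; t] => TBracket (lie_term_decode s) (lie_term_decode t)
  | _ => TZero
  end.

Lemma lie_term_encodeK : cancel lie_term_encode lie_term_decode.
Proof.
by elim=> [x||s IHs t IHt|k t IHt|s IHs t IHt] //=; rewrite ?IHs ?IHt.
Qed.

HB.instance Definition _ := Choice.copy (lie_term K X)
  (can_type lie_term_encodeK).

End TermChoice.

Inductive lie_equiv (K : comNzRingType) (X : Type) :
  lie_term K X -> lie_term K X -> Prop :=
| lie_equiv_refl t : lie_equiv t t
| lie_equiv_sym s t : lie_equiv s t -> lie_equiv t s
| lie_equiv_trans s t r : lie_equiv s t -> lie_equiv t r -> lie_equiv s r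
| lie_equiv_add s s' t t' : lie_equiv s s' -> lie_equiv t t' ->
    lie_equiv (TAdd s t) (TAdd s' t')
| lie_equiv_scale k t t' : lie_equiv t t' ->
    lie_equiv (TScale k t) (TScale k t')
| lie_equiv_bracket s s' t t' : lie_equiv s s' -> lie_equiv t t' ->
    lie_equiv (TBracket s t) (TBracket s' t')
| lie_equiv_addA s t r :
    lie_equiv (TAdd s (TAdd t r)) (TAdd (TAdd s t) r)
| lie_equiv_addC s t : lie_equiv (TAdd s t) (TAdd t s)
| lie_equiv_add0 t : lie_equiv (TAdd TZero t) t
| lie_equiv_addN t : lie_equiv (TAdd (TScale (-1) t) t) TZero
| lie_equiv_scaleA k l t :
    lie_equiv (TScale k (TScale l t)) (TScale (k * l) t)
| lie_equiv_scale1 t : lie_equiv (TScale 1 t) t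
| lie_equiv_scaleDr k s t :
    lie_equiv (TScale k (TAdd s t)) (TAdd (TScale k s) (TScale k t))
| lie_equiv_scaleDl k l t :
    lie_equiv (TScale (k + l) t) (TAdd (TScale k t) (TScale l t))
| lie_equiv_linearl k s t r :
    lie_equiv (TBracket (TAdd (TScale k s) t) r)
              (TAdd (TScale k (TBracket s r)) (TBracket t r))
| lie_equiv_linearr k s t r :
    lie_equiv (TBracket s (TAdd (TScale k t) r))
              (TAdd (TScale k (TBracket s t)) (TBracket s r))
| lie_equiv_alternating t : lie_equiv (TBracket t t) TZero
| lie_equiv_jacobi s t r :
    lie_equiv (TAdd (TAdd (TBracket s (TBracket t r))
                          (TBracket t (TBracket r s)))
                    (TBracket r (TBracket s t))) TZero.

Section FreeLie.
Variables (K : comNzRingType) (X : choiceType).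
Implicit Types (s t r : lie_term K X) (x : X) (k l : K).

Definition lie_equivb : rel (lie_term K X) := fun s t => `[< lie_equiv s t >].

Lemma lie_equivb_refl : reflexive lie_equivb.
Proof. by move=> t; apply/asboolP; exact: lie_equiv_refl. Qed.

Lemma lie_equivb_sym : symmetric lie_equivb.
Proof. by move=> s t; apply/asboolP/asboolP; exact: lie_equiv_sym. Qed.

Lemma lie_equivb_trans : transitive lie_equivb.
Proof.
move=> t s r /asboolP st /asboolP tr; apply/asboolP.
exact: lie_equiv_trans tr.
Qed.

Canonical lie_equiv_rel :=
  EquivRel lie_equivb lie_equivb_refl lie_equivb_sym lie_equivb_trans.

Definition freeLie : Type := {eq_quot lie_equiv_rel}.
HB.instance Definition _ : EqQuotient _ lie_equiv_rel freeLie :=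
  EqQuotient.on freeLie.
HB.instance Definition _ := Choice.on freeLie.

Local Notation cl := (\pi_freeLie).

Lemma freeLie_eqP s t : cl s = cl t <-> lie_equiv s t.
Proof.
split=> [/eqmodP /asboolP //|st]; apply/eqmodP; exact/asboolP.
Qed.

Lemma freeLie_repr t : lie_equiv (repr (cl t)) t.
Proof. by apply/freeLie_eqP; rewrite reprK. Qed.

Definition free_gen x : freeLie := cl (TGen x).
Definition free_zero : freeLie := cl TZero.
Definition free_add (u v : freeLie) : freeLie := cl (TAdd (repr u) (repr v)).
Definition free_scale k (u : freeLie) : freeLie := cl (TScale k (repr u)).
Definition free_bracket (u v : freeLie) : freeLie :=
  cl (TBracket (repr u) (repr v)).

Lemma free_addE s t : free_add (cl s) (cl t) = cl (TAdd s t).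
Proof. by apply/freeLie_eqP; apply: lie_equiv_add; exact: freeLie_repr. Qed.

Lemma free_scaleE k t : free_scale k (cl t) = cl (TScale k t).
Proof. by apply/freeLie_eqP; apply: lie_equiv_scale; exact: freeLie_repr. Qed.

Lemma free_bracketE s t : free_bracket (cl s) (cl t) = cl (TBracket s t).
Proof. by apply/freeLie_eqP; apply: lie_equiv_bracket; exact: freeLie_repr. Qed.

Lemma freeLieW (P : freeLie -> Prop) : (forall t, P (cl t)) -> forall u, P u.
Proof. by move=> Pcl u; rewrite -[u]reprK. Qed.

#[local] Opaque free_add free_scale free_bracket.

Let free_op_E := (free_addE, free_scaleE, free_bracketE).

Lemma free_addA : associative free_add.
Proof.
elim/freeLieW=> s; elim/freeLieW=> t; elim/freeLieW=> r; rewrite !free_op_E.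
apply/freeLie_eqP; exact: lie_equiv_addA.
Qed.

Lemma free_addC : commutative free_add.
Proof.
elim/freeLieW=> s; elim/freeLieW=> t; rewrite !free_op_E.
apply/freeLie_eqP; exact: lie_equiv_addC.
Qed.

Lemma free_add0 : left_id free_zero free_add.
Proof.
by elim/freeLieW=> t; rewrite !free_op_E; apply/freeLie_eqP; exact: lie_equiv_add0.
Qed.

Lemma free_addN : left_inverse free_zero (free_scale (-1)) free_add.
Proof.
by elim/freeLieW=> t; rewrite !free_op_E; apply/freeLie_eqP; exact: lie_equiv_addN.
Qed.

HB.instance Definition _ :=
  GRing.isZmodule.Build freeLie free_addA free_addC free_add0 free_addN.

Lemma free_scaleA k l (u : freeLie) :
  free_scale k (free_scale l u) = free_scale (k * l) u.
Proof.
elim/freeLieW: u => t; rewrite !free_op_E.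
apply/freeLie_eqP; exact: lie_equiv_scaleA.
Qed.

Lemma free_scale1 : left_id 1 free_scale.
Proof.
by elim/freeLieW=> t; rewrite !free_op_E; apply/freeLie_eqP; exact: lie_equiv_scale1.
Qed.

Lemma free_scaleDr : right_distributive free_scale +%R.
Proof.
move=> k; elim/freeLieW=> s; elim/freeLieW=> t.
rewrite /GRing.add /= !free_op_E; apply/freeLie_eqP; exact: lie_equiv_scaleDr.
Qed.

Lemma free_scaleDl u : {morph free_scale^~ u : k l / k + l}.
Proof.
move=> k l; elim/freeLieW: u => t.
rewrite [RHS]/GRing.add /= !free_op_E; apply/freeLie_eqP; exact: lie_equiv_scaleDl.
Qed.

HB.instance Definition _ := GRing.Zmodule_isLmodule.Build K freeLie
  free_scaleA free_scale1 free_scaleDr free_scaleDl.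

Lemma freeLie_pi0 : cl TZero = 0. Proof. by []. Qed.
#[local] Transparent free_add free_scale free_bracket.

Lemma freeLie_piD s t : cl (TAdd s t) = cl s + cl t.
Proof. by rewrite -free_addE. Qed.
Lemma freeLie_piZ k t : cl (TScale k t) = k *: cl t.
Proof. by rewrite -free_scaleE. Qed.

Lemma free_linearl k (u v w : freeLie) :
  free_bracket (k *: u + v) w = k *: free_bracket u w + free_bracket v w.
Proof.
elim/freeLieW: u => s; elim/freeLieW: v => t; elim/freeLieW: w => r.
rewrite -freeLie_piZ -freeLie_piD !free_op_E -freeLie_piZ -freeLie_piD.
apply/freeLie_eqP; exact: lie_equiv_linearl.
Qed.

Lemma free_linearr k (u v w : freeLie) :
  free_bracket u (k *: v + w) = k *: free_bracket u v + free_bracket u w.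
Proof.
elim/freeLieW: u => s; elim/freeLieW: v => t; elim/freeLieW: w => r.
rewrite -freeLie_piZ -freeLie_piD !free_op_E -freeLie_piZ -freeLie_piD.
apply/freeLie_eqP; exact: lie_equiv_linearr.
Qed.

Lemma free_alternating (u : freeLie) : free_bracket u u = 0.
Proof.
elim/freeLieW: u => t; rewrite !free_op_E.
apply/freeLie_eqP; exact: lie_equiv_alternating.
Qed.

Lemma free_jacobi (u v w : freeLie) :
  free_bracket u (free_bracket v w) + free_bracket v (free_bracket w u)
    + free_bracket w (free_bracket u v) = 0.
Proof.
elim/freeLieW: u => s; elim/freeLieW: v => t; elim/freeLieW: w => r.
rewrite !free_op_E -!freeLie_piD; apply/freeLie_eqP; exact: lie_equiv_jacobi.
Qed.

HB.instance Definition _ := Lmodule_isLieAlgebra.Build K freeLie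
  free_linearl free_linearr free_alternating free_jacobi.

Lemma freeLie_piB s t : cl (TBracket s t) = ⟦cl s, cl t⟧.
Proof. by rewrite -free_bracketE. Qed.

Lemma freeLie_ind (P : freeLie -> Prop) :
    (forall x, P (free_gen x)) -> P 0 ->
    (forall u v, P u -> P v -> P (u + v)) ->
    (forall k u, P u -> P (k *: u)) ->
    (forall u v, P u -> P v -> P ⟦u, v⟧) ->
  forall u, P u.
Proof.
move=> Pgen P0 PD PZ PB; elim/freeLieW.
elim=> [x||s Ps t Pt|k t Pt|s Ps t Pt]; first exact: Pgen.
- exact: P0.
- by rewrite freeLie_piD; exact: PD.
- by rewrite freeLie_piZ; exact: PZ.
- by rewrite freeLie_piB; exact: PB.
Qed.

End FreeLie.

Section LieAlgebraTheory.
Variables (K : comNzRingType) (L : lieAlgType K).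
Implicit Types u v w : L.

Lemma lieDl u v w : ⟦u + v, w⟧ = ⟦u, w⟧ + ⟦v, w⟧.
Proof. by have := lie_linearl 1 u v w; rewrite !scale1r. Qed.
Lemma lieDr u v w : ⟦u, v + w⟧ = ⟦u, v⟧ + ⟦u, w⟧.
Proof. by have := lie_linearr 1 u v w; rewrite !scale1r. Qed.
Lemma lie0l u : ⟦0, u⟧ = 0.
Proof. by apply: (addrI ⟦0, u⟧); rewrite -lieDl !addr0. Qed.
Lemma lie0r u : ⟦u, 0⟧ = 0.
Proof. by apply: (addrI ⟦u, 0⟧); rewrite -lieDr !addr0. Qed.
Lemma lieZl k u v : ⟦k *: u, v⟧ = k *: ⟦u, v⟧.
Proof. by have := lie_linearl k u 0 v; rewrite lie0l !addr0. Qed.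
Lemma lieZr k u v : ⟦u, k *: v⟧ = k *: ⟦u, v⟧.
Proof. by have := lie_linearr k u v 0; rewrite lie0r !addr0. Qed.
Lemma lieC u v : ⟦u, v⟧ = - ⟦v, u⟧.
Proof.
apply/eqP; rewrite -addr_eq0; apply/eqP.
by have := lie_alternating (u + v);
  rewrite lieDl !lieDr !lie_alternating add0r addr0.
Qed.

End LieAlgebraTheory.

Section UniversalProperty.
Variables (K : comNzRingType) (X : choiceType) (M : lieAlgType K) (f : X -> M).

Fixpoint lie_eval (t : lie_term K X) : M :=
  match t with
  | TGen x => f x
  | TZero => 0
  | TAdd s t => lie_eval s + lie_eval t
  | TScale k t => k *: lie_eval t
  | TBracket s t => ⟦lie_eval s, lie_eval t⟧
  end.

Lemma lie_eval_equiv s t : lie_equiv s t -> lie_eval s = lie_eval t.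
Proof.
elim=> {s t} //=.
- by move=> s t r _ -> _ ->.
- by move=> s s' t t' _ -> _ ->.
- by move=> k t t' _ ->.
- by move=> s s' t t' _ -> _ ->.
- by move=> *; rewrite addrA.
- by move=> *; rewrite addrC.
- by move=> *; rewrite add0r.
- by move=> *; rewrite scaleN1r addNr.
- by move=> *; rewrite scalerA.
- by move=> *; rewrite scale1r.
- by move=> *; rewrite scalerDr.
- by move=> *; rewrite scalerDl.
- by move=> *; rewrite lie_linearl.
- by move=> *; rewrite lie_linearr.
- by move=> *; rewrite lie_alternating.
- by move=> *; rewrite lie_jacobi.
Qed.

Definition free_lift (u : freeLie K X) : M := lie_eval (repr u).

Lemma free_liftE t : free_lift (\pi_(freeLie K X) t) = lie_eval t.
Proof. exact/lie_eval_equiv/freeLie_repr. Qed.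

Lemma free_lift_gen x : free_lift (free_gen K x) = f x.
Proof. exact: free_liftE. Qed.

Lemma free_lift_morphism : lie_morphism free_lift.
Proof.
split=> [k|]; elim/freeLieW=> s; elim/freeLieW=> t.
  by rewrite -freeLie_piZ -freeLie_piD !free_liftE.
by rewrite -freeLie_piB !free_liftE.
Qed.

Lemma free_lift_unique (g : freeLie K X -> M) :
  lie_morphism g -> (forall x, g (free_gen K x) = f x) -> g =1 free_lift.
Proof.
case=> gl gB gx; case: free_lift_morphism => hl hB.
have g0 : g 0 = 0.
  by have := gl (-1) 0 0; rewrite scaler0 addr0 scaleN1r addNr.
have h0 : free_lift 0 = 0.
  by have := hl (-1) 0 0; rewrite scaler0 addr0 scaleN1r addNr.
elim/freeLie_ind=> [x||u v Hu Hv|k u Hu|u v Hu Hv].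
- by rewrite gx free_lift_gen.
- by rewrite g0 h0.
- by have := gl 1 u v; have := hl 1 u v; rewrite !scale1r => -> ->; rewrite Hu Hv.
- by have := gl k u 0; have := hl k u 0; rewrite g0 h0 !addr0 => -> ->; rewrite Hu.
- by rewrite gB hB Hu Hv.
Qed.

End UniversalProperty.

Section Derivation.
Variables (K : comNzRingType) (X : choiceType) (f : X -> freeLie K X).
Local Notation cl := (\pi_(freeLie K X)).

Fixpoint der_eval (t : lie_term K X) : freeLie K X :=
  match t with
  | TGen x => f x
  | TZero => 0
  | TAdd s t => der_eval s + der_eval t
  | TScale k t => k *: der_eval t
  | TBracket s t => ⟦der_eval s, cl t⟧ + ⟦cl s, der_eval t⟧
  end.

Lemma der_eval_equiv s t : lie_equiv s t -> der_eval s = der_eval t.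
Proof.
elim=> {s t} //=.
- by move=> s t r _ -> _ ->.
- by move=> s s' t t' _ -> _ ->.
- by move=> k t t' _ ->.
- by move=> s s' t t' /freeLie_eqP-> -> /freeLie_eqP-> ->.
- by move=> *; rewrite addrA.
- by move=> *; rewrite addrC.
- by move=> *; rewrite add0r.
- by move=> *; rewrite scaleN1r addNr.
- by move=> *; rewrite scalerA.
- by move=> *; rewrite scale1r.
- by move=> *; rewrite scalerDr.
- by move=> *; rewrite scalerDl.
- by move=> k s t r; rewrite freeLie_piD freeLie_piZ !lie_linearl scalerDr addrACA.
- by move=> k s t r; rewrite freeLie_piD freeLie_piZ !lie_linearr scalerDr addrACA.
- by move=> t; rewrite lieC addNr.
- move=> s t r; rewrite !freeLie_piB !lieDr.
  set S := cl s; set T := cl t; set R := cl r.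
  set S' := der_eval s; set T' := der_eval t; set R' := der_eval r.
  rewrite [LHS](AC ((1*2)*(1*2)*(1*2)) ((1*6*8)*(2*4*9)*(3*5*7))) /=.
  by rewrite !lie_jacobi !addr0.
Qed.

Definition free_der (u : freeLie K X) : freeLie K X := der_eval (repr u).

Lemma free_derE t : free_der (cl t) = der_eval t.
Proof. exact/der_eval_equiv/freeLie_repr. Qed.

Lemma free_der_gen x : free_der (free_gen K x) = f x.
Proof. exact: free_derE. Qed.

Lemma free_derP : lie_derivation free_der.
Proof.
split=> [k|]; elim/freeLieW=> s; elim/freeLieW=> t.
  by rewrite -freeLie_piZ -freeLie_piD !free_derE.
by rewrite -freeLie_piB !free_derE.
Qed.

Lemma free_der_unique (d : freeLie K X -> freeLie K X) :
  lie_derivation d -> (forall x, d (free_gen K x) = f x) -> d =1 free_der.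
Proof.
case=> gl gB gx; case: free_derP => hl hB.
have g0 : d 0 = 0.
  by have := gl (-1) 0 0; rewrite scaler0 addr0 scaleN1r addNr.
have h0 : free_der 0 = 0.
  by have := hl (-1) 0 0; rewrite scaler0 addr0 scaleN1r addNr.
elim/freeLie_ind=> [x||u v Hu Hv|k u Hu|u v Hu Hv].
- by rewrite gx free_der_gen.
- by rewrite g0 h0.
- by have := gl 1 u v; have := hl 1 u v; rewrite !scale1r => -> ->; rewrite Hu Hv.
- by have := gl k u 0; have := hl k u 0; rewrite g0 h0 !addr0 => -> ->; rewrite Hu.
- by rewrite gB hB Hu Hv.
Qed.

End Derivation.

(* free_homog K X n is the component L_n: the smallest family of subspaces    *)
(* with the generators in L_1 and [L_p, L_q] contained in L_(p + q).          *)
Inductive free_homog (K : comNzRingType) (X : choiceType) :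
  nat -> freeLie K X -> Prop :=
| free_homog_gen x : free_homog 1 (free_gen K x)
| free_homog_bracket p q u v :
    free_homog p u -> free_homog q v -> free_homog (p + q) ⟦u, v⟧
| free_homog0 n : free_homog n 0
| free_homogD n u v : free_homog n u -> free_homog n v -> free_homog n (u + v)
| free_homogZ n k u : free_homog n u -> free_homog n (k *: u).

Section SubspaceBasis.
Variables (K : fieldType) (V : lmodType K).

Definition is_basis (W : V -> Prop) (n : nat) (e : n.-tuple V) : Prop :=
  (forall v, W v <-> exists c : 'I_n -> K, v = \sum_(i < n) c i *: tnth e i)
  /\ (forall c : 'I_n -> K,
        \sum_(i < n) c i *: tnth e i = 0 -> forall i, c i = 0).

Definition has_dim (W : V -> Prop) (n : nat) : Prop :=
  exists e : n.-tuple V, is_basis W e.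

End SubspaceBasis.

Section LieInvariants.
Variable K : fieldType.
Local Notation L := (freeLie K 'I_3).

Definition sl3 (D : 'M[K]_3) : Prop := \tr D = 0.

(* Generator j stands for the j-th standard column vector, so D sends it to   *)
(* the j-th column of D.                                                      *)
Definition sl3_act (D : 'M[K]_3) : L -> L :=
  free_der (fun j => \sum_(i < 3) D i j *: free_gen K i).

Definition lie_invariant (j : nat) (Z : L) : Prop :=
  free_homog j Z /\ forall D : 'M[K]_3, sl3 D -> sl3_act D Z = 0.

Let a : L := free_gen K (@Ordinal 3 0 isT).
Let b : L := free_gen K (@Ordinal 3 1 isT).
Let c : L := free_gen K (@Ordinal 3 2 isT).

Definition I9_1 : L :=
     ⟦⟦⟦⟦b, a⟧, a⟧, ⟦c, b⟧⟧, ⟦⟦c, b⟧, ⟦c, a⟧⟧⟧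
   - ⟦⟦⟦⟦b, a⟧, b⟧, ⟦c, a⟧⟧, ⟦⟦c, b⟧, ⟦c, a⟧⟧⟧
   + ⟦⟦⟦⟦b, a⟧, c⟧, ⟦b, a⟧⟧, ⟦⟦c, b⟧, ⟦c, a⟧⟧⟧
   - ⟦⟦⟦⟦b, a⟧, c⟧, ⟦c, b⟧⟧, ⟦⟦c, a⟧, ⟦b, a⟧⟧⟧
   - ⟦⟦⟦⟦c, a⟧, a⟧, ⟦c, b⟧⟧, ⟦⟦c, b⟧, ⟦b, a⟧⟧⟧
   + ⟦⟦⟦⟦c, a⟧, b⟧, ⟦c, a⟧⟧, ⟦⟦c, b⟧, ⟦b, a⟧⟧⟧
   + ⟦⟦⟦⟦c, a⟧, b⟧, ⟦c, b⟧⟧, ⟦⟦c, a⟧, ⟦b, a⟧⟧⟧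
   - ⟦⟦⟦⟦c, a⟧, c⟧, ⟦b, a⟧⟧, ⟦⟦c, b⟧, ⟦b, a⟧⟧⟧
   - ⟦⟦⟦⟦c, b⟧, b⟧, ⟦c, a⟧⟧, ⟦⟦c, a⟧, ⟦b, a⟧⟧⟧
   + ⟦⟦⟦⟦c, b⟧, c⟧, ⟦b, a⟧⟧, ⟦⟦c, a⟧, ⟦b, a⟧⟧⟧.

Definition I9_2 : L :=
     ⟦⟦⟦⟦c, a⟧, ⟦b, a⟧⟧, ⟦b, a⟧⟧, ⟦⟦c, b⟧, c⟧⟧
   - ⟦⟦⟦⟦c, a⟧, ⟦b, a⟧⟧, ⟦c, a⟧⟧, ⟦⟦c, b⟧, b⟧⟧
   - 2%:R *: ⟦⟦⟦⟦c, a⟧, ⟦b, a⟧⟧, ⟦c, b⟧⟧, ⟦⟦b, a⟧, c⟧⟧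
   + ⟦⟦⟦⟦c, a⟧, ⟦b, a⟧⟧, ⟦c, b⟧⟧, ⟦⟦c, a⟧, b⟧⟧
   - ⟦⟦⟦⟦c, b⟧, ⟦b, a⟧⟧, ⟦b, a⟧⟧, ⟦⟦c, a⟧, c⟧⟧
   + ⟦⟦⟦⟦c, b⟧, ⟦b, a⟧⟧, ⟦c, a⟧⟧, ⟦⟦b, a⟧, c⟧⟧
   + ⟦⟦⟦⟦c, b⟧, ⟦b, a⟧⟧, ⟦c, a⟧⟧, ⟦⟦c, a⟧, b⟧⟧
   - ⟦⟦⟦⟦c, b⟧, ⟦b, a⟧⟧, ⟦c, b⟧⟧, ⟦⟦c, a⟧, a⟧⟧
   - ⟦⟦⟦⟦c, b⟧, ⟦c, a⟧⟧, ⟦c, a⟧⟧, ⟦⟦b, a⟧, b⟧⟧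
   + ⟦⟦⟦⟦c, b⟧, ⟦c, a⟧⟧, ⟦c, b⟧⟧, ⟦⟦b, a⟧, a⟧⟧.

Definition I9_3 : L :=
     ⟦⟦⟦⟦c, a⟧, ⟦b, a⟧⟧, ⟦b, a⟧⟧, ⟦⟦c, b⟧, c⟧⟧
   - ⟦⟦⟦⟦c, a⟧, ⟦b, a⟧⟧, ⟦c, a⟧⟧, ⟦⟦c, b⟧, b⟧⟧
   + ⟦⟦⟦⟦c, a⟧, ⟦b, a⟧⟧, ⟦c, b⟧⟧, ⟦⟦b, a⟧, c⟧⟧
   - 2%:R *: ⟦⟦⟦⟦c, a⟧, ⟦b, a⟧⟧, ⟦c, b⟧⟧, ⟦⟦c, a⟧, b⟧⟧
   - ⟦⟦⟦⟦c, b⟧, ⟦b, a⟧⟧, ⟦b, a⟧⟧, ⟦⟦c, a⟧, c⟧⟧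
   - ⟦⟦⟦⟦c, b⟧, ⟦b, a⟧⟧, ⟦c, a⟧⟧, ⟦⟦b, a⟧, c⟧⟧
   + 2%:R *: ⟦⟦⟦⟦c, b⟧, ⟦b, a⟧⟧, ⟦c, a⟧⟧, ⟦⟦c, a⟧, b⟧⟧
   + ⟦⟦⟦⟦c, b⟧, ⟦b, a⟧⟧, ⟦c, b⟧⟧, ⟦⟦c, a⟧, a⟧⟧
   - ⟦⟦⟦⟦⟦b, a⟧, a⟧, a⟧, ⟦c, b⟧⟧, ⟦⟦c, b⟧, c⟧⟧
   + ⟦⟦⟦⟦⟦b, a⟧, a⟧, b⟧, ⟦c, a⟧⟧, ⟦⟦c, b⟧, c⟧⟧
   + ⟦⟦⟦⟦⟦b, a⟧, a⟧, b⟧, ⟦c, b⟧⟧, ⟦⟦c, a⟧, c⟧⟧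
   - ⟦⟦⟦⟦⟦b, a⟧, a⟧, c⟧, ⟦b, a⟧⟧, ⟦⟦c, b⟧, c⟧⟧
   - 2%:R *: ⟦⟦⟦⟦⟦b, a⟧, a⟧, c⟧, ⟦c, b⟧⟧, ⟦⟦b, a⟧, c⟧⟧
   + ⟦⟦⟦⟦⟦b, a⟧, a⟧, c⟧, ⟦c, b⟧⟧, ⟦⟦c, a⟧, b⟧⟧
   - ⟦⟦⟦⟦⟦b, a⟧, b⟧, b⟧, ⟦c, a⟧⟧, ⟦⟦c, a⟧, c⟧⟧
   + ⟦⟦⟦⟦⟦b, a⟧, b⟧, c⟧, ⟦b, a⟧⟧, ⟦⟦c, a⟧, c⟧⟧
   + 2%:R *: ⟦⟦⟦⟦⟦b, a⟧, b⟧, c⟧, ⟦c, a⟧⟧, ⟦⟦b, a⟧, c⟧⟧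
   - ⟦⟦⟦⟦⟦b, a⟧, b⟧, c⟧, ⟦c, a⟧⟧, ⟦⟦c, a⟧, b⟧⟧
   - ⟦⟦⟦⟦⟦b, a⟧, b⟧, c⟧, ⟦c, b⟧⟧, ⟦⟦c, a⟧, a⟧⟧
   - 2%:R *: ⟦⟦⟦⟦⟦b, a⟧, c⟧, c⟧, ⟦b, a⟧⟧, ⟦⟦b, a⟧, c⟧⟧
   + ⟦⟦⟦⟦⟦b, a⟧, c⟧, c⟧, ⟦b, a⟧⟧, ⟦⟦c, a⟧, b⟧⟧
   + ⟦⟦⟦⟦⟦b, a⟧, c⟧, c⟧, ⟦c, b⟧⟧, ⟦⟦b, a⟧, a⟧⟧
   + ⟦⟦⟦⟦⟦c, a⟧, a⟧, a⟧, ⟦c, b⟧⟧, ⟦⟦c, b⟧, b⟧⟧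
   - ⟦⟦⟦⟦⟦c, a⟧, a⟧, b⟧, ⟦c, a⟧⟧, ⟦⟦c, b⟧, b⟧⟧
   + ⟦⟦⟦⟦⟦c, a⟧, a⟧, b⟧, ⟦c, b⟧⟧, ⟦⟦b, a⟧, c⟧⟧
   - 2%:R *: ⟦⟦⟦⟦⟦c, a⟧, a⟧, b⟧, ⟦c, b⟧⟧, ⟦⟦c, a⟧, b⟧⟧
   + ⟦⟦⟦⟦⟦c, a⟧, a⟧, c⟧, ⟦b, a⟧⟧, ⟦⟦c, b⟧, b⟧⟧
   + ⟦⟦⟦⟦⟦c, a⟧, a⟧, c⟧, ⟦c, b⟧⟧, ⟦⟦b, a⟧, b⟧⟧
   - ⟦⟦⟦⟦⟦c, a⟧, b⟧, b⟧, ⟦c, a⟧⟧, ⟦⟦b, a⟧, c⟧⟧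
   + 2%:R *: ⟦⟦⟦⟦⟦c, a⟧, b⟧, b⟧, ⟦c, a⟧⟧, ⟦⟦c, a⟧, b⟧⟧
   + ⟦⟦⟦⟦⟦c, a⟧, b⟧, b⟧, ⟦c, b⟧⟧, ⟦⟦c, a⟧, a⟧⟧
   + ⟦⟦⟦⟦⟦c, a⟧, b⟧, c⟧, ⟦b, a⟧⟧, ⟦⟦b, a⟧, c⟧⟧
   - 2%:R *: ⟦⟦⟦⟦⟦c, a⟧, b⟧, c⟧, ⟦b, a⟧⟧, ⟦⟦c, a⟧, b⟧⟧
   - ⟦⟦⟦⟦⟦c, a⟧, b⟧, c⟧, ⟦c, a⟧⟧, ⟦⟦b, a⟧, b⟧⟧
   - ⟦⟦⟦⟦⟦c, a⟧, b⟧, c⟧, ⟦c, b⟧⟧, ⟦⟦b, a⟧, a⟧⟧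
   + ⟦⟦⟦⟦⟦c, a⟧, c⟧, c⟧, ⟦b, a⟧⟧, ⟦⟦b, a⟧, b⟧⟧
   - ⟦⟦⟦⟦⟦c, b⟧, b⟧, b⟧, ⟦c, a⟧⟧, ⟦⟦c, a⟧, a⟧⟧
   + ⟦⟦⟦⟦⟦c, b⟧, b⟧, c⟧, ⟦b, a⟧⟧, ⟦⟦c, a⟧, a⟧⟧
   + ⟦⟦⟦⟦⟦c, b⟧, b⟧, c⟧, ⟦c, a⟧⟧, ⟦⟦b, a⟧, a⟧⟧
   - ⟦⟦⟦⟦⟦c, b⟧, c⟧, c⟧, ⟦b, a⟧⟧, ⟦⟦b, a⟧, a⟧⟧.

Definition I9_4 : L :=
     ⟦⟦⟦⟦b, a⟧, a⟧, ⟦b, a⟧⟧, ⟦⟦⟦c, b⟧, c⟧, c⟧⟧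
   - ⟦⟦⟦⟦b, a⟧, a⟧, ⟦c, a⟧⟧, ⟦⟦⟦c, b⟧, b⟧, c⟧⟧
   - ⟦⟦⟦⟦b, a⟧, a⟧, ⟦c, b⟧⟧, ⟦⟦⟦b, a⟧, c⟧, c⟧⟧
   + ⟦⟦⟦⟦b, a⟧, a⟧, ⟦c, b⟧⟧, ⟦⟦⟦c, a⟧, b⟧, c⟧⟧
   - ⟦⟦⟦⟦b, a⟧, b⟧, ⟦b, a⟧⟧, ⟦⟦⟦c, a⟧, c⟧, c⟧⟧
   + ⟦⟦⟦⟦b, a⟧, b⟧, ⟦c, a⟧⟧, ⟦⟦⟦c, a⟧, b⟧, c⟧⟧
   - ⟦⟦⟦⟦b, a⟧, b⟧, ⟦c, b⟧⟧, ⟦⟦⟦c, a⟧, a⟧, c⟧⟧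
   - ⟦⟦⟦⟦b, a⟧, c⟧, ⟦b, a⟧⟧, ⟦⟦c, b⟧, ⟦c, a⟧⟧⟧
   + 2%:R *: ⟦⟦⟦⟦b, a⟧, c⟧, ⟦b, a⟧⟧, ⟦⟦⟦b, a⟧, c⟧, c⟧⟧
   - ⟦⟦⟦⟦b, a⟧, c⟧, ⟦b, a⟧⟧, ⟦⟦⟦c, a⟧, b⟧, c⟧⟧
   + 2%:R *: ⟦⟦⟦⟦b, a⟧, c⟧, ⟦c, a⟧⟧, ⟦⟦c, b⟧, ⟦b, a⟧⟧⟧
   - 2%:R *: ⟦⟦⟦⟦b, a⟧, c⟧, ⟦c, a⟧⟧, ⟦⟦⟦b, a⟧, b⟧, c⟧⟧
   + ⟦⟦⟦⟦b, a⟧, c⟧, ⟦c, a⟧⟧, ⟦⟦⟦c, a⟧, b⟧, b⟧⟧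
   - 2%:R *: ⟦⟦⟦⟦b, a⟧, c⟧, ⟦c, b⟧⟧, ⟦⟦c, a⟧, ⟦b, a⟧⟧⟧
   + 2%:R *: ⟦⟦⟦⟦b, a⟧, c⟧, ⟦c, b⟧⟧, ⟦⟦⟦b, a⟧, a⟧, c⟧⟧
   - ⟦⟦⟦⟦b, a⟧, c⟧, ⟦c, b⟧⟧, ⟦⟦⟦c, a⟧, a⟧, b⟧⟧
   - ⟦⟦⟦⟦c, a⟧, a⟧, ⟦b, a⟧⟧, ⟦⟦⟦c, b⟧, b⟧, c⟧⟧
   + ⟦⟦⟦⟦c, a⟧, a⟧, ⟦c, a⟧⟧, ⟦⟦⟦c, b⟧, b⟧, b⟧⟧
   - ⟦⟦⟦⟦c, a⟧, a⟧, ⟦c, b⟧⟧, ⟦⟦c, b⟧, ⟦b, a⟧⟧⟧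
   + ⟦⟦⟦⟦c, a⟧, a⟧, ⟦c, b⟧⟧, ⟦⟦⟦b, a⟧, b⟧, c⟧⟧
   - ⟦⟦⟦⟦c, a⟧, a⟧, ⟦c, b⟧⟧, ⟦⟦⟦c, a⟧, b⟧, b⟧⟧
   - ⟦⟦⟦⟦c, a⟧, b⟧, ⟦b, a⟧⟧, ⟦⟦⟦b, a⟧, c⟧, c⟧⟧
   + 2%:R *: ⟦⟦⟦⟦c, a⟧, b⟧, ⟦b, a⟧⟧, ⟦⟦⟦c, a⟧, b⟧, c⟧⟧
   - 2%:R *: ⟦⟦⟦⟦c, a⟧, b⟧, ⟦c, a⟧⟧, ⟦⟦c, b⟧, ⟦b, a⟧⟧⟧
   + ⟦⟦⟦⟦c, a⟧, b⟧, ⟦c, a⟧⟧, ⟦⟦⟦b, a⟧, b⟧, c⟧⟧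
   - 2%:R *: ⟦⟦⟦⟦c, a⟧, b⟧, ⟦c, a⟧⟧, ⟦⟦⟦c, a⟧, b⟧, b⟧⟧
   + 2%:R *: ⟦⟦⟦⟦c, a⟧, b⟧, ⟦c, b⟧⟧, ⟦⟦c, a⟧, ⟦b, a⟧⟧⟧
   - ⟦⟦⟦⟦c, a⟧, b⟧, ⟦c, b⟧⟧, ⟦⟦⟦b, a⟧, a⟧, c⟧⟧
   + 2%:R *: ⟦⟦⟦⟦c, a⟧, b⟧, ⟦c, b⟧⟧, ⟦⟦⟦c, a⟧, a⟧, b⟧⟧
   + ⟦⟦⟦⟦c, a⟧, c⟧, ⟦b, a⟧⟧, ⟦⟦c, b⟧, ⟦b, a⟧⟧⟧
   - ⟦⟦⟦⟦c, a⟧, c⟧, ⟦b, a⟧⟧, ⟦⟦⟦b, a⟧, b⟧, c⟧⟧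
   + ⟦⟦⟦⟦c, a⟧, c⟧, ⟦c, a⟧⟧, ⟦⟦⟦b, a⟧, b⟧, b⟧⟧
   - ⟦⟦⟦⟦c, a⟧, c⟧, ⟦c, b⟧⟧, ⟦⟦⟦b, a⟧, a⟧, b⟧⟧
   - ⟦⟦⟦⟦c, b⟧, b⟧, ⟦b, a⟧⟧, ⟦⟦⟦c, a⟧, a⟧, c⟧⟧
   + ⟦⟦⟦⟦c, b⟧, b⟧, ⟦c, a⟧⟧, ⟦⟦c, a⟧, ⟦b, a⟧⟧⟧
   + ⟦⟦⟦⟦c, b⟧, b⟧, ⟦c, a⟧⟧, ⟦⟦⟦c, a⟧, a⟧, b⟧⟧
   - ⟦⟦⟦⟦c, b⟧, b⟧, ⟦c, b⟧⟧, ⟦⟦⟦c, a⟧, a⟧, a⟧⟧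
   - ⟦⟦⟦⟦c, b⟧, c⟧, ⟦b, a⟧⟧, ⟦⟦c, a⟧, ⟦b, a⟧⟧⟧
   + ⟦⟦⟦⟦c, b⟧, c⟧, ⟦b, a⟧⟧, ⟦⟦⟦b, a⟧, a⟧, c⟧⟧
   - ⟦⟦⟦⟦c, b⟧, c⟧, ⟦c, a⟧⟧, ⟦⟦⟦b, a⟧, a⟧, b⟧⟧
   + ⟦⟦⟦⟦c, b⟧, c⟧, ⟦c, b⟧⟧, ⟦⟦⟦b, a⟧, a⟧, a⟧⟧.

End LieInvariants.

(* Main.v *)
From HB Require Import structures.
Require Import Defs.
From Stdlib Require Import ZArith.
From mathcomp Require Import all_boot all_order all_algebra.
From mathcomp Require Import boolp functions reals complex.
From mathcomp Require Import ring ssrZ.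

Set Implicit Arguments.
Unset Strict Implicit.
Unset Printing Implicit Defensive.

Import GRing.Theory Num.Theory.
Local Open Scope ring_scope.

(** The proof transports everything to the tensor algebra of V = L_1, where
    elements are finite families of coefficients indexed by words.

    Expanding brackets as commutators maps the free Lie algebra to
    noncommutative series ([expand]).  In characteristic 0 this map is injective
    on L_n for n > 0, by the Dynkin-Specht-Wever identity ([dynkin_expand]): the
    operator sending a word x1 ... xn to [x1, [x2, ... [x(n-1), xn]]] sends the
    expansion of Z in L_n back to n Z.  Hence an identity in L_9 is an identity
    between integer combinations of words of length 9, and can be decided by
    computing with tries of integers ([trie], [ev]).

    A matrix of sl_3 acts on series as a derivation.  The elements I_9^(k) are
    invariant because the elementary matrix E_ij maps their expansions to 0 if
    i <> j and to three times themselves if i = j; they are independent because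
    four linear forms on coefficients are dual to them.  Both facts are
    computations.

    That they span is the substance of the theorem.  Let f be the expansion of
    an invariant Z in L_9.
    - The diagonal matrices force every word in f to contain each letter three
      times ([sl3_invariant_content]).
    - Exponentiating E_ij and E_ji yields a group element exchanging the letters
      i and j up to sign, so f changes sign when two letters are exchanged
      ([swap_sign]).
    - These sign relations, with the relations that say that E_ab kills f,
      determine f from its 42 coefficients at ballot words, that is, at
      words every prefix of which has at least as many a as b and as many b as
      c.  Each step of this elimination uses a relation in which all
      words but one are already known to have coefficient 0
      ([sl3_invariant_eq0]).
    - Products of three determinants, one product for each standard tableau of
      shape 3 x 3, are invariant, and the matrix of their coefficients at the
      ballot words is unitriangular.  Therefore f is a combination of
      them ([unitriangular_solve]).
    - Applying the Dynkin operator, 9 Z is a combination of the images of these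
      42 products, and each of these images is computed to be an integer
      combination of the four elements I_9^(k) ([dynkin_det_in_span]). *)

(** * Noncommutative series and the commutator bracket *)

Section Series.
Variables (K : comNzRingType) (X : finType).

(** A series is given by the coefficients of all words; [K^o] is [K] as a module
    over itself, which makes series a module for the pointwise operations. *)
Definition series : Type := seq X -> K^o.
HB.instance Definition _ := GRing.Lmodule.on series.
Implicit Types (f g h : series) (k : K) (x y : X).

Lemma seriesP f g : f =1 g -> f = g. Proof. exact: funext. Qed.

(** Left division by a letter.  A series is determined by its constant term and
    its left quotients, so products, derivations and substitutions can be both
    defined and compared by recursion on words. *)
Definition lder x f : series := fun w => f (x :: w).

Lemma series_eqP f g :
  f [::] = g [::] -> (forall x, lder x f = lder x g) -> f = g.
Proof.
move=> fg0 fgS; apply: seriesP => -[|x w] //.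
exact: (congr1 (fun h => h w) (fgS x)).
Qed.

(** The Cauchy product, through its recursion
    x \ (f g) = (x \ f) g + f_0 (x \ g) for left quotients, where f_0 is the
    constant term of f. *)
Fixpoint mul_coef f g (w : seq X) : K :=
  if w is x :: w' then mul_coef (lder x f) g w' + f [::] * g w
  else f [::] * g [::].
Definition smul f g : series := mul_coef f g.

Lemma lder_smul x f g :
  lder x (smul f g) = smul (lder x f) g + f [::] *: lder x g.
Proof. by []. Qed.

Lemma smul_linearl k f g h : smul (k *: f + g) h = k *: smul f h + smul g h.
Proof.
apply: seriesP => w; elim: w f g => [|x w IH] f g /=.
  by rewrite mulrDl -mulrA.
rewrite -[LHS]/(smul (k *: lder x f + lder x g) h w
                + (k * f [::] + g [::]) * h (x :: w)) IH mulrDl -mulrA.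
rewrite -[RHS]/(k * (smul (lder x f) h w + f [::] * h (x :: w))
                + (smul (lder x g) h w + g [::] * h (x :: w))).
by rewrite mulrDr addrACA.
Qed.

Lemma smul_linearr k f g h : smul f (k *: g + h) = k *: smul f g + smul f h.
Proof.
apply: seriesP => w; elim: w f => [|x w IH] f /=.
  by rewrite mulrDr mulrCA.
rewrite -[LHS]/(smul (lder x f) (k *: g + h) w
                + f [::] * (k * g (x :: w) + h (x :: w))) IH mulrDr mulrCA.
rewrite -[RHS]/(k * (smul (lder x f) g w + f [::] * g (x :: w))
                + (smul (lder x f) h w + f [::] * h (x :: w))).
by rewrite mulrDr addrACA.
Qed.

Lemma smul0l f : smul 0 f = 0.
Proof.
by have := smul_linearl (-1) 0 0 f; rewrite scaler0 addr0 scaleN1r addNr.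
Qed.
Lemma smul0r f : smul f 0 = 0.
Proof.
by have := smul_linearr (-1) f 0 0; rewrite scaler0 addr0 scaleN1r addNr.
Qed.
Lemma smulDl f g h : smul (f + g) h = smul f h + smul g h.
Proof. by have := smul_linearl 1 f g h; rewrite !scale1r. Qed.
Lemma smulDr f g h : smul f (g + h) = smul f g + smul f h.
Proof. by have := smul_linearr 1 f g h; rewrite !scale1r. Qed.
Lemma smulZl k f g : smul (k *: f) g = k *: smul f g.
Proof. by have := smul_linearl k f 0 g; rewrite smul0l !addr0. Qed.
Lemma smulZr k f g : smul f (k *: g) = k *: smul f g.
Proof. by have := smul_linearr k f g 0; rewrite smul0r !addr0. Qed.
Lemma smulBl f g h : smul (f - g) h = smul f h - smul g h.
Proof. by rewrite smulDl -scaleN1r smulZl scaleN1r. Qed.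
Lemma smulBr f g h : smul f (g - h) = smul f g - smul f h.
Proof. by rewrite smulDr -scaleN1r smulZr scaleN1r. Qed.

Lemma smulA f g h : smul f (smul g h) = smul (smul f g) h.
Proof.
apply: seriesP => w; elim: w f => [|x w IH] f /=; first by rewrite mulrA.
rewrite -[LHS]/(smul (lder x f) (smul g h) w
                + f [::] * (smul (lder x g) h w + g [::] * h (x :: w))).
rewrite -[RHS]/(smul (smul (lder x f) g + f [::] *: lder x g) h w
                + f [::] * g [::] * h (x :: w)).
by rewrite IH smulDl smulZl mulrDr mulrA addrA.
Qed.

Definition commutator f g := smul f g - smul g f.

Lemma commutator_linearl k f g h :
  commutator (k *: f + g) h = k *: commutator f h + commutator g h.
Proof.
by rewrite /commutator smul_linearl smul_linearr scalerBr opprD addrACA.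
Qed.
Lemma commutator_linearr k f g h :
  commutator f (k *: g + h) = k *: commutator f g + commutator f h.
Proof.
by rewrite /commutator smul_linearl smul_linearr scalerBr opprD addrACA.
Qed.
Lemma commutator_alternating f : commutator f f = 0.
Proof. exact: subrr. Qed.
Lemma commutator_jacobi f g h :
  commutator f (commutator g h) + commutator g (commutator h f)
    + commutator h (commutator f g) = 0.
Proof.
rewrite /commutator !smulBl !smulBr !smulA !opprB.
set a := smul (smul f g) h; set b := smul (smul f h) g.
set c := smul (smul g h) f; set d := smul (smul g f) h.
set e := smul (smul h f) g; set l := smul (smul h g) f.
have cancel (r s t u v z : K) :
  r - s + (z - t) + (t - u + (s - v)) + (v - z + (u - r)) = 0 by ring.
by apply: seriesP => w; exact: cancel.
Qed.

HB.instance Definition _ := Lmodule_isLieAlgebra.Build K series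
  commutator_linearl commutator_linearr commutator_alternating
  commutator_jacobi.

Definition letter_series x : series := fun w => (w == [:: x])%:R.

Definition one_series : series := fun w => (w == [::])%:R.

Lemma lder_letter x y :
  lder y (letter_series x) = (y == x)%:R *: one_series.
Proof.
apply: seriesP => w.
by rewrite -[RHS]/((y == x)%:R * (w == [::])%:R) -natrM mulnb.
Qed.

Definition homogeneous n f := forall w, size w != n -> f w = 0.

Lemma homogeneousS n f x : homogeneous n.+1 f -> homogeneous n (lder x f).
Proof. by move=> fn w wn; apply: fn. Qed.

Lemma homogeneous_nil n f : homogeneous n.+1 f -> f [::] = 0.
Proof. by apply. Qed.

Lemma smul_homogeneous0 f g : homogeneous 0 f -> smul f g = f [::] *: g.
Proof.
move=> f0; apply: series_eqP => // x; rewrite lder_smul.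
rewrite (_ : lder x f = 0) ?smul0l ?add0r //.
by apply: seriesP => w; apply: f0.
Qed.

Lemma lder_smul_homogeneous x n f g :
  homogeneous n.+1 f -> lder x (smul f g) = smul (lder x f) g.
Proof. by move=> fn; rewrite lder_smul (homogeneous_nil fn) scale0r addr0. Qed.

Lemma smul_homogeneous p q f g :
  homogeneous p f -> homogeneous q g -> homogeneous (p + q)%N (smul f g).
Proof.
move=> + gq; elim: p f => [|p IH] f fp w.
  by rewrite smul_homogeneous0 // => wq; rewrite -[LHS]/(_ * g w) gq ?mulr0.
case: w => [_|x w wpq].
  by rewrite -[LHS]/(_ * g _) (homogeneous_nil fp) mul0r.
rewrite -[LHS]/(lder x (smul f g) w) (lder_smul_homogeneous _ _ fp).
by apply: IH => //; exact: homogeneousS.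
Qed.

End Series.

(** * Derivations and transvections acting on letters *)

Section LetterOperators.
Variables (K : comNzRingType) (X : finType).
Local Notation series := (series K X).
Implicit Types (f g : series) (k : K) (w : seq X) (M : X -> X -> K).

(** The derivation whose value at the letter [x] is the sum of the [M y x] times
    [y], so that [M] acts on column vectors; see [sder_letter] and [sder_smul]. *)
Fixpoint der_coef M f w : K :=
  if w is x :: w' then
    der_coef M (lder x f) w' + \sum_y M x y * f (y :: w')
  else 0.
Definition sder M f : series := der_coef M f.

Lemma series_sumE (I : finType) (F : I -> series) w :
  (\sum_i F i) w = \sum_i F i w :> K.
Proof. by elim/big_rec2: _ => // i u v _ <-. Qed.

Lemma lder_sder M f x :
  lder x (sder M f) = sder M (lder x f) + \sum_y M x y *: lder y f.
Proof. by apply: seriesP => w; rewrite /= -[RHS]/(_ + _) series_sumE. Qed.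

Lemma sder_linear M k f g :
  sder M (k *: f + g) = k *: sder M f + sder M g.
Proof.
apply: seriesP => w; elim: w f g => [|x w IH] f g /=.
  by rewrite -[RHS]/(k * 0 + 0) mulr0 addr0.
rewrite -[LHS]/(sder M (k *: lder x f + lder x g) w
                + \sum_y M x y * (k * f (y :: w) + g (y :: w))).
rewrite -[RHS]/(k * (sder M (lder x f) w + \sum_y M x y * f (y :: w))
                + (sder M (lder x g) w + \sum_y M x y * g (y :: w))).
rewrite IH mulrDr addrACA; congr (_ + _).
by rewrite mulr_sumr -big_split /=; apply: eq_bigr => y _; rewrite mulrDr mulrCA.
Qed.

Lemma sder0 M : sder M 0 = 0.
Proof.
by have := sder_linear M (-1) 0 0; rewrite scaler0 addr0 scaleN1r addNr.
Qed.
Lemma sderZ M k f : sder M (k *: f) = k *: sder M f.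
Proof. by have := sder_linear M k f 0; rewrite sder0 !addr0. Qed.
Lemma sderD M f g : sder M (f + g) = sder M f + sder M g.
Proof. by have := sder_linear M 1 f g; rewrite !scale1r. Qed.
Lemma sderB M f g : sder M (f - g) = sder M f - sder M g.
Proof. by rewrite sderD -scaleN1r sderZ scaleN1r. Qed.

Lemma sder_one M : sder M (@one_series K X) = 0.
Proof.
apply: series_eqP => // x; rewrite lder_sder.
rewrite (_ : lder x (@one_series K X) = 0) // sder0 add0r.
by rewrite big1 // => y _; rewrite (_ : lder y (@one_series K X) = 0) ?scaler0.
Qed.

Lemma sder_letter M x :
  sder M (letter_series K x) = \sum_y M y x *: letter_series K y.
Proof.
apply: series_eqP => [|z].
  by rewrite series_sumE big1 // => y _; exact: mulr0.
rewrite lder_sder lder_letter sderZ sder_one scaler0 add0r.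
rewrite (bigD1 x) //= big1 ?addr0 => [|y /negPf yx]; last first.
  by rewrite lder_letter yx scale0r scaler0.
rewrite lder_letter eqxx scale1r.
have -> : lder z (\sum_y M y x *: letter_series K y)
    = \sum_y M y x *: lder z (letter_series K y).
  by elim/big_rec2: _ => // y f g _ <-.
rewrite (bigD1 z) //= big1 ?addr0 => [|y /negPf yz].
  by rewrite lder_letter eqxx scale1r.
by rewrite lder_letter eq_sym yz scale0r scaler0.
Qed.

Lemma sder_smul M f g :
  sder M (smul f g) = smul (sder M f) g + smul f (sder M g).
Proof.
have smul_suml (I : finType) (F : I -> series) h :
    smul (\sum_i F i) h = \sum_i smul (F i) h.
  by elim/big_rec2: _ => [|k u v _ <-]; rewrite ?smul0l ?smulDl.
apply: seriesP => w; elim: w f => [|x w IH] f.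
  by rewrite /= -[RHS]/(0 * _ + f [::] * 0) mul0r mulr0 addr0.
rewrite -[LHS]/(lder x (sder M (smul f g)) w) lder_sder lder_smul.
rewrite [smul _ g + _]addrC sder_linear.
rewrite -[LHS]/(f [::] * sder M (lder x g) w + sder M (smul (lder x f) g) w
  + (\sum_y M x y *: lder y (smul f g)) w) IH.
rewrite -[RHS]/(lder x (smul (sder M f) g + smul f (sder M g)) w).
rewrite -[LHS]/((f [::] *: sder M (lder x g) + (smul (sder M (lder x f)) g
  + smul (lder x f) (sder M g)) + \sum_y M x y *: lder y (smul f g)) w).
congr ((_ : series) w).
rewrite -[RHS]/(lder x (smul (sder M f) g) + lder x (smul f (sder M g))).
rewrite !lder_smul scale0r addr0 !lder_sder smulDl smul_suml scalerDr.
rewrite (eq_bigr (fun y => smul (M x y *: lder y f) g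
                           + f [::] *: (M x y *: lder y g))); last first.
  by move=> y _; rewrite lder_smul scalerDr smulZl !scalerA mulrC.
rewrite big_split /= -scaler_sumr.
by rewrite [LHS](AC (1*2*2) ((2*4)*(3*(1*5)))).
Qed.

(** The elementary matrix E_ij. *)
Definition unit_fun (i j x y : X) : K := ((x == i) && (y == j))%:R.

Lemma sum_unit_fun i j x (F : X -> series) :
  \sum_y unit_fun i j x y *: F y = (x == i)%:R *: F j.
Proof.
rewrite (bigD1 j) //= big1 ?addr0 => [|y /negPf yj].
  by rewrite /unit_fun eqxx andbT.
by rewrite /unit_fun yj andbF scale0r.
Qed.

Lemma lder_sder_unit i j f x : lder x (sder (unit_fun i j) f)
  = sder (unit_fun i j) (lder x f) + (x == i)%:R *: lder j f.
Proof. by rewrite lder_sder sum_unit_fun. Qed.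

Lemma sder_sum_unit M f :
  sder M f = \sum_i \sum_j M i j *: sder (unit_fun i j) f.
Proof.
apply: seriesP => w; elim: w f => [|x w IH] f.
  rewrite series_sumE big1 // => i _; rewrite series_sumE big1 // => j _.
  exact: mulr0.
rewrite -[LHS]/(lder x (sder M f) w) lder_sder.
rewrite -[LHS]/(sder M (lder x f) w + (\sum_y M x y *: lder y f) w) IH.
rewrite -[RHS]/(lder x (\sum_i \sum_j M i j *: sder (unit_fun i j) f) w).
rewrite -[LHS]/((\sum_i \sum_j M i j *: sder (unit_fun i j) (lder x f)
  + \sum_y M x y *: lder y f) w); congr ((_ : series) w).
have lder_sum (I : finType) (F : I -> series) :
    lder x (\sum_i F i) = \sum_i lder x (F i).
  by elim/big_rec2: _ => // k u v _ <-.
rewrite lder_sum [RHS](eq_bigr (fun i => \sum_j M i j *: sder (unit_fun i j) (lder x f)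
   + \sum_j (x == i)%:R *: (M i j *: lder j f))) => [|i _].
  rewrite big_split /=; congr (_ + _).
  rewrite [RHS](bigD1 x) //= [X in _ = _ + X]big1 ?addr0 => [|i /negPf ix].
    by apply: eq_bigr => j _; rewrite eqxx scale1r.
  by rewrite big1 // => j _; rewrite eq_sym ix scale0r.
rewrite lder_sum -big_split; apply: eq_bigr => j _ /=.
rewrite -[LHS]/(M i j *: lder x (sder (unit_fun i j) f)) lder_sder_unit.
by rewrite scalerDr !scalerA mulrC.
Qed.

(** E_ii measures the weight: it multiplies a word by its number of letters
    [i]. *)
Lemma sder_unit_diag i f w : sder (unit_fun i i) f w = (count_mem i w)%:R * f w.
Proof.
elim: w f => [|x w IH] f; first by rewrite mul0r.
rewrite -[LHS]/(lder x (sder (unit_fun i i) f) w) lder_sder_unit.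
rewrite -[LHS]/(sder (unit_fun i i) (lder x f) w + (x == i)%:R * f (i :: w)) IH.
rewrite /= natrD mulrDl addrC; congr (_ + _).
by case: eqP => [->|]; rewrite ?mul0r.
Qed.

Variables (i j : X).
Hypothesis neq_ij : i != j.
Local Notation Eij := (unit_fun i j).

(** The divided power E_ij^m / m!, which replaces [m] letters [j] by [i] in all
    possible ways. *)
Fixpoint dpow_coef m f w : K :=
  if w is x :: w' then
    dpow_coef m (lder x f) w'
    + (if m is m'.+1 then (x == i)%:R * dpow_coef m' (lder j f) w' else 0)
  else (m == 0)%:R * f [::].

(** The substitution j := j + s i, which is the exponential of s E_ij. *)
Fixpoint transvection_coef (s : K) f w : K :=
  if w is x :: w' then
    transvection_coef s (lder x f) w'
    + (x == i)%:R * (s * transvection_coef s (lder j f) w')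
  else f [::].

Lemma transvection_dpow s f w n : (size w <= n)%N ->
  transvection_coef s f w = \sum_(m < n.+1) s ^+ m * dpow_coef m f w.
Proof.
elim: w f n => [|x w IH] f n wn.
  rewrite big_ord_recl big1 ?addr0 => [|m _]; first by rewrite /= !mul1r.
  by rewrite /= mul0r mulr0.
case: n wn => // n wn; rewrite /= (IH (lder x f) n.+1 (leqW wn)).
rewrite [in RHS](eq_bigr _ (fun m _ => mulrDr _ _ _)) big_split /=; congr (_ + _).
rewrite big_ord_recl mulr0 add0r (IH (lder j f) n wn) !mulr_sumr.
by apply: eq_bigr => m _ /=; rewrite exprS; ring.
Qed.

Lemma dpow_linear m k f g w :
  dpow_coef m (k *: f + g) w = k * dpow_coef m f w + dpow_coef m g w.
Proof.
elim: w m f g => [|y w IH] m f g /=; first by rewrite mulrDr mulrCA.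
rewrite -[lder y (_ + _)]/(k *: lder y f + lder y g) IH.
case: m => [|m]; first by rewrite !addr0.
by rewrite -[lder j (_ + _)]/(k *: lder j f + lder j g) IH; ring.
Qed.

Lemma dpow0l m w : dpow_coef m 0 w = 0.
Proof.
by have := dpow_linear m (-1) 0 0 w; rewrite scaler0 addr0 mulN1r addNr.
Qed.

(** The identity (m + 1) E^(m+1)/(m+1)! = (E^m/m!) E, stated without division.
    It needs [i != j], so that the new letters [i] are not replaced again. *)
Lemma dpow_sder m f w :
  m.+1%:R * dpow_coef m.+1 f w = dpow_coef m (sder Eij f) w.
Proof.
elim: w m f => [|x w IH] m f; first by rewrite /= mul0r !mulr0.
rewrite /= lder_sder_unit [sder _ _ + _]addrC dpow_linear -IH.
case: m => [|m]; first by rewrite !mul1r addr0 addrC.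
rewrite lder_sder_unit [j == i]eq_sym (negPf neq_ij) scale0r addr0 -IH.
by rewrite -[m.+2]addn1 natrD; ring.
Qed.

Definition transvection s f : series := transvection_coef s f.

Lemma lder_transvection s f x : lder x (transvection s f)
  = transvection s (lder x f) + ((x == i)%:R * s) *: transvection s (lder j f).
Proof.
by apply: seriesP => w; rewrite -[RHS]/(_ + (_ * s) * _) -mulrA.
Qed.

Lemma transvection_linear s k f g :
  transvection s (k *: f + g) = k *: transvection s f + transvection s g.
Proof.
apply: seriesP => w; elim: w f g => [//|x w IH] f g.
have lderE y h : transvection s h (y :: w) = transvection s (lder y h) w
    + ((y == i)%:R * s) * transvection s (lder j h) w.
  by rewrite -[LHS]/(lder y (transvection s h) w) lder_transvection.
rewrite -[RHS]/(k * _ + _) !lderE.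
rewrite -[lder x (_ + _)]/(k *: lder x f + lder x g) IH.
rewrite -[lder j (_ + _)]/(k *: lder j f + lder j g) IH.
rewrite -[LHS]/(k * transvection s (lder x f) w + transvection s (lder x g) w
  + _ * (k * transvection s (lder j f) w + transvection s (lder j g) w)).
by ring.
Qed.

End LetterOperators.

Definition swap (X : eqType) (i j x : X) :=
  if x == i then j else if x == j then i else x.

Section SwapSign.
Variables (K : numFieldType) (X : finType) (i j : X).
Hypothesis neq_ij : i != j.
Local Notation series := (series K X).
Implicit Types (f : series) (w : seq X).

Lemma dpow0 (a b : X) f w : dpow_coef a b 0 f w = f w.
Proof.
by elim: w f => [|x w IH] f /=; rewrite ?mul1r // addr0 IH.
Qed.

(** A series killed by E_ab is killed by its divided powers, hence fixed by the
    exponential.  Dividing by m + 1 is where characteristic 0 enters. *)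
Lemma transvection_id (a b : X) s f : a != b ->
  sder (unit_fun K a b) f = 0 -> transvection a b s f = f.
Proof.
move=> ab Ef0; apply: seriesP => w.
rewrite -[LHS]/(transvection_coef a b s f w) (transvection_dpow _ _ _ _ (leqnn _)).
rewrite big_ord_recl expr0 mul1r dpow0 big1 ?addr0 // => m _.
suff -> : dpow_coef a b (lift ord0 m) f w = 0 by rewrite mulr0.
apply: (@mulfI _ (lift ord0 m)%:R); first by rewrite pnatr_eq0.
by rewrite mulr0 [LHS](dpow_sder ab) Ef0 dpow0l.
Qed.

(** The product exp(E_ij) exp(- E_ji) exp(E_ij) is, in the plane of [i] and [j],
    the matrix with rows (0 1) and (-1 0).  It fixes f, and it exchanges the
    two letters with one sign for each letter [j]. *)
Lemma swap_sign f w :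
    sder (unit_fun K i j) f = 0 -> sder (unit_fun K j i) f = 0 ->
  f w = (-1) ^+ count_mem j w * f (map (swap i j) w).
Proof.
move=> Eij0 Eji0.
have neq_ji : j != i by rewrite eq_sym.
pose T := @transvection K X i j 1; pose S := @transvection K X j i (-1).
pose W g := T (S (T g)).
have TD g h : T (g + h) = T g + T h.
  by have := transvection_linear i j 1 1 g h; rewrite !scale1r.
have SD g h : S (g + h) = S g + S h.
  by have := transvection_linear j i (-1) 1 g h; rewrite !scale1r.
have SN g : S (- g) = - S g.
  apply/eqP; rewrite -addr_eq0 -SD addNr; apply/eqP.
  by apply: (addrI (S 0)); rewrite -SD !addr0.
have TN g : T (- g) = - T g.
  apply/eqP; rewrite -addr_eq0 -TD addNr; apply/eqP.
  by apply: (addrI (T 0)); rewrite -TD !addr0.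
have lderT x g :
    lder x (T g) = if x == i then T (lder i g + lder j g) else T (lder x g).
  rewrite [LHS]lder_transvection mulr1; case: eqP => [->|_].
    by rewrite scale1r TD.
  by rewrite scale0r addr0.
have lderS x g :
    lder x (S g) = if x == j then S (lder j g - lder i g) else S (lder x g).
  rewrite [LHS]lder_transvection mulrN1; case: eqP => [->|_].
    by rewrite scaleN1r SD SN.
  by rewrite oppr0 scale0r addr0.
have lderW x g : lder x (W g) =
    if x == i then W (lder j g) else if x == j then - W (lder i g) else W (lder x g).
  rewrite /W !lderT !lderS !lderT eqxx (negPf neq_ij) (negPf neq_ji) eqxx.
  case: ifP => [_|xi]; first by rewrite -SD addrCA subrr addr0.
  case: ifP => [_|_]; last by rewrite xi.
  by rewrite TD [in X in S X]opprD addrCA subrr addr0 SN TN.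
have Wf : W f = f by rewrite /W /T /S !transvection_id.
rewrite -[in LHS]Wf; elim: w f {Eij0 Eji0 Wf} => [|x w IH] g; first by rewrite mul1r.
rewrite -[LHS]/(lder x (W g) w) lderW /= /swap; case: ifP => [/eqP ->|_].
  by rewrite IH (negPf neq_ij).
case: ifP => _; last by rewrite IH.
by rewrite -[LHS]/(- W (lder i g) w) IH exprS mulN1r mulNr.
Qed.
End SwapSign.

(** * The free Lie algebra embeds into series *)

Section Dynkin.
Variables (K : comNzRingType) (X : finType).
Local Notation L := (freeLie K X).
Local Notation series := (series K X).
Local Notation gen := (@free_gen K X).
Implicit Types (f g : series) (k : K) (Y Z : L).

(** The degree [n] part of a series acts on the free Lie algebra, a word acting
    as the composite of the adjoint actions of its letters. *)
Fixpoint ad_series n f Z : L :=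
  if n is n'.+1 then \sum_x ⟦gen x, ad_series n' (lder x f) Z⟧
  else (f [::] : K) *: Z.

(** The word x1 ... xn is sent to the right-normed bracket of its letters; the
    recursion stops at single letters, which are sent to generators. *)
Fixpoint dynkin n f : L :=
  if n is n'.+1 then
    \sum_x (if n' is 0 then (f [:: x] : K) *: gen x
            else ⟦gen x, dynkin n' (lder x f)⟧)
  else 0.

Lemma ad_series_linear n k f g Z :
  ad_series n (k *: f + g) Z = k *: ad_series n f Z + ad_series n g Z.
Proof.
elim: n f g => [|n IH] f g /=; first by rewrite scalerA -scalerDl.
rewrite scaler_sumr -big_split /=; apply: eq_bigr => x _.
by rewrite -lie_linearr -IH.
Qed.

Lemma ad_series_linearr n k f Y Z :
  ad_series n f (k *: Y + Z) = k *: ad_series n f Y + ad_series n f Z.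
Proof.
elim: n f => [|n IH] f /=; first by rewrite scalerDr !scalerA mulrC.
rewrite scaler_sumr -big_split /=; apply: eq_bigr => x _.
by rewrite -lie_linearr -IH.
Qed.

Lemma dynkin_linear n k f g :
  dynkin n (k *: f + g) = k *: dynkin n f + dynkin n g.
Proof.
elim: n f g => [|n IH] f g /=; first by rewrite scaler0 addr0.
rewrite scaler_sumr -big_split /=; apply: eq_bigr => x _.
case: n IH => [|n] IH; first by rewrite scalerA -scalerDl.
by rewrite -lie_linearr -IH.
Qed.

Lemma ad_series0 n Z : ad_series n 0 Z = 0.
Proof.
by have := ad_series_linear n (-1) 0 0 Z; rewrite scaler0 addr0 scaleN1r addNr.
Qed.
Lemma ad_seriesB n f g Z :
  ad_series n (f - g) Z = ad_series n f Z - ad_series n g Z.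
Proof.
by have := ad_series_linear n (-1) g f Z; rewrite !scaleN1r ![- _ + _]addrC.
Qed.
Lemma ad_seriesZr n f k Z : ad_series n f (k *: Z) = k *: ad_series n f Z.
Proof.
have ad0 : ad_series n f 0 = 0.
  by have := ad_series_linearr n (-1) f 0 0; rewrite scaler0 addr0 scaleN1r addNr.
by have := ad_series_linearr n k f Z 0; rewrite ad0 !addr0.
Qed.
Lemma dynkin0 n : dynkin n 0 = 0.
Proof.
by have := dynkin_linear n (-1) 0 0; rewrite scaler0 addr0 scaleN1r addNr.
Qed.
Lemma dynkinB n f g : dynkin n (f - g) = dynkin n f - dynkin n g.
Proof.
by have := dynkin_linear n (-1) g f; rewrite !scaleN1r ![- _ + _]addrC.
Qed.
Lemma dynkinZ n k f : dynkin n (k *: f) = k *: dynkin n f.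
Proof. by have := dynkin_linear n k f 0; rewrite dynkin0 !addr0. Qed.

Lemma ad_series_smul p q f g Z : homogeneous p f ->
  ad_series (p + q)%N (smul f g) Z = ad_series p f (ad_series q g Z).
Proof.
elim: p f => [|p IH] f fp.
  rewrite smul_homogeneous0 //.
  by have := ad_series_linear q (f [::]) g 0 Z; rewrite ad_series0 !addr0.
rewrite addSn /=; apply: eq_bigr => x _.
by rewrite (lder_smul_homogeneous _ _ fp) IH //; exact: homogeneousS.
Qed.

(** The first factor of a product only contributes adjoint actions.  For
    [q = 0] the last letter would come from [f], and the formula fails. *)
Lemma dynkin_smul p q f g : (0 < q)%N -> homogeneous p f ->
  dynkin (p + q)%N (smul f g) = ad_series p f (dynkin q g).
Proof.
move=> q0; elim: p f => [|p IH] f fp.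
  by rewrite smul_homogeneous0 // dynkinZ.
rewrite addSn /=; apply: eq_bigr => x _.
rewrite -(IH _ (homogeneousS x fp)) -(lder_smul_homogeneous _ _ fp).
by case: (p + q)%N (ltn_addl p q0).
Qed.

Definition expand : L -> series := free_lift (@letter_series K X).

Lemma expand_linear k Y Z : expand (k *: Y + Z) = k *: expand Y + expand Z.
Proof. exact: (free_lift_morphism _).1. Qed.
Lemma expand_bracket Y Z :
  expand ⟦Y, Z⟧ = smul (expand Y) (expand Z) - smul (expand Z) (expand Y).
Proof. exact: (free_lift_morphism _).2. Qed.
Lemma expand_gen x : expand (gen x) = letter_series K x.
Proof. exact: free_lift_gen. Qed.
Lemma expand0 : expand 0 = 0.
Proof.
by have := expand_linear (-1) 0 0; rewrite scaler0 addr0 scaleN1r addNr.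
Qed.
Lemma expandD Y Z : expand (Y + Z) = expand Y + expand Z.
Proof. by have := expand_linear 1 Y Z; rewrite !scale1r. Qed.
Lemma expandZ k Z : expand (k *: Z) = k *: expand Z.
Proof. by have := expand_linear k Z 0; rewrite expand0 !addr0. Qed.
Lemma expandB Y Z : expand (Y - Z) = expand Y - expand Z.
Proof. by rewrite expandD -scaleN1r expandZ scaleN1r. Qed.

Lemma homog0_eq0 n Z : free_homog n Z -> n = 0 -> Z = 0.
Proof.
elim=> {n Z} // [p q u v _ IHu _ IHv /eqP|n u v _ IHu _ IHv n0|n k u _ IH n0].
- by rewrite addn_eq0 => /andP[/eqP p0 _]; rewrite IHu // lie0l.
- by rewrite IHu // IHv // addr0.
- by rewrite IH // scaler0.
Qed.

Lemma expand_homogeneous n Z : free_homog n Z -> homogeneous n (expand Z).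
Proof.
elim=> {n Z} [x|p q u v _ IHu _ IHv|n|n u v _ IHu _ IHv|n k u _ IH].
- rewrite expand_gen => w wn; rewrite /letter_series.
  by have /negPf -> : w != [:: x] by apply: contraNneq wn => ->.
- rewrite expand_bracket => w wn.
  have uv0 := smul_homogeneous IHu IHv wn.
  have vu0 : smul (expand v) (expand u) w = 0.
    by apply: (smul_homogeneous IHv IHu); rewrite addnC.
  by rewrite -[LHS]/(smul _ _ w - smul _ _ w) uv0 vu0 subrr.
- by rewrite expand0.
- by rewrite expandD => w wn; rewrite -[LHS]/(_ w + _ w) IHu ?IHv ?addr0.
- by rewrite expandZ => w wn; rewrite -[LHS]/(_ * _ w) IH ?mulr0.
Qed.

(** The action of an expanded bracket is the commutator of the actions of its
    two sides, which is the action of the bracket by the Jacobi identity. *)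
Lemma ad_series_expand n Z Y :
  free_homog n Z -> ad_series n (expand Z) Y = ⟦Z, Y⟧.
Proof.
move=> Zn; elim: {n Z} Zn Y => [x|p q u v uh IHu vh IHv|n|n u v _ IHu _ IHv|n k u _ IH] Y.
- rewrite expand_gen /= (bigD1 x) //= big1 ?addr0 => [|y /negPf yx].
    by rewrite /lder /letter_series eqxx scale1r.
  by rewrite /lder /letter_series eqseq_cons yx scale0r lie0r.
- rewrite expand_bracket ad_seriesB.
  rewrite (ad_series_smul _ _ _ (expand_homogeneous uh)) addnC.
  rewrite (ad_series_smul _ _ _ (expand_homogeneous vh)) !(IHu, IHv).
  apply/eqP; rewrite subr_eq; apply/eqP.
  have := lie_jacobi u v Y => /eqP; rewrite -addrA addr_eq0 => /eqP ->.
  by rewrite opprD addrC [⟦Y, u⟧]lieC [⟦Y, _⟧]lieC -scaleN1r lieZr scaleN1r !opprK.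
- by rewrite expand0 ad_series0 lie0l.
- by rewrite expandD -[expand u]scale1r ad_series_linear scale1r IHu IHv lieDl.
- have := ad_series_linear n k (expand u) 0 Y.
  by rewrite ad_series0 !addr0 expandZ lieZl IH.
Qed.

(** The Dynkin-Specht-Wever identity.  By [dynkin_smul] and [ad_series_expand]
    the map Z |-> dynkin (expand Z) is a derivation that fixes the generators,
    so it is multiplication by the degree. *)
Lemma dynkin_expand n Z : free_homog n Z -> dynkin n (expand Z) = n%:R *: Z.
Proof.
elim=> {n Z} [x|p q u v uh IHu vh IHv|n|n u v _ IHu _ IHv|n k u _ IH].
- rewrite expand_gen /= (bigD1 x) //= big1 ?addr0 => [|y /negPf yx].
    by rewrite /letter_series eqxx.
  by rewrite /letter_series eqseq_cons yx scale0r.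
- case: (posnP p) => [p0|p0].
    by rewrite (homog0_eq0 uh p0) lie0l expand0 dynkin0 scaler0.
  case: (posnP q) => [q0|q0].
    by rewrite (homog0_eq0 vh q0) lie0r expand0 dynkin0 scaler0.
  rewrite expand_bracket dynkinB (dynkin_smul _ q0 (expand_homogeneous uh)).
  rewrite [in X in _ - X]addnC (dynkin_smul _ p0 (expand_homogeneous vh)).
  rewrite IHu IHv !ad_seriesZr !ad_series_expand // natrD scalerDl.
  by rewrite [⟦v, u⟧]lieC scalerN opprK addrC.
- by rewrite expand0 dynkin0 scaler0.
- rewrite expandD -[expand u]scale1r dynkin_linear scale1r IHu IHv.
  by rewrite scalerDr.
- by rewrite expandZ dynkinZ IH !scalerA mulrC.
Qed.

Lemma dynkin_homog n f : free_homog n (dynkin n f).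
Proof.
elim: n f => [|n IH] f /=; first exact: free_homog0.
elim/big_rec: _ => [|x Z _ Zn]; first exact: free_homog0.
apply: free_homogD => //; case: n IH {Zn} => [|n] IH.
  by apply: free_homogZ; exact: free_homog_gen.
by rewrite -[n.+2]add1n; apply: free_homog_bracket; [exact: free_homog_gen|].
Qed.

Definition letter_act (M : X -> X -> K) (x : X) : L := \sum_y M y x *: gen y.

(** Both sides are derivations along [expand] that agree on generators. *)
Lemma expand_free_der M Z :
  expand (free_der (letter_act M) Z) = sder M (expand Z).
Proof.
have [dl dB] := free_derP (letter_act M).
have d0 : free_der (letter_act M) 0 = 0.
  by have := dl (-1) 0 0; rewrite scaler0 addr0 scaleN1r addNr.
elim/freeLie_ind: Z => [x||u v Hu Hv|k u Hu|u v Hu Hv].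
- rewrite free_der_gen expand_gen /letter_act.
  have expand_sum : expand (\sum_y M y x *: gen y)
      = \sum_y M y x *: letter_series K y.
    elim/big_rec2: _ => [|y f Z _ <-]; first exact: expand0.
    by rewrite expand_linear expand_gen.
  by rewrite expand_sum sder_letter.
- by rewrite d0 expand0 sder0.
- have := dl 1 u v; rewrite !scale1r => ->.
  by rewrite !expandD sderD Hu Hv.
- have := dl k u 0; rewrite d0 !addr0 => ->.
  by rewrite !expandZ sderZ Hu.
- rewrite dB expandD !expand_bracket Hu Hv sderB !sder_smul opprD addrACA.
  by congr (_ + _); rewrite addrC.
Qed.

Lemma free_homog_der M n Z :
  free_homog n Z -> free_homog n (free_der (letter_act M) Z).
Proof.
have [dl dB] := free_derP (letter_act M).
have d0 : free_der (letter_act M) 0 = 0.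
  by have := dl (-1) 0 0; rewrite scaler0 addr0 scaleN1r addNr.
elim=> {n Z} [x|p q u v uh IHu vh IHv|n|n u v _ IHu _ IHv|n k u _ IH].
- rewrite free_der_gen /letter_act.
  elim/big_rec: _ => [|y Z _ Zn]; first exact: free_homog0.
  apply: free_homogD => //; apply: free_homogZ; exact: free_homog_gen.
- by rewrite dB; apply: free_homogD; apply: free_homog_bracket.
- by rewrite d0; exact: free_homog0.
- have := dl 1 u v; rewrite !scale1r => ->; exact: free_homogD.
- by have := dl k u 0; rewrite d0 !addr0 => ->; exact: free_homogZ.
Qed.

End Dynkin.


(** The way every identity in the free Lie algebra is proved below. *)
Lemma expand_inj0 (K : numFieldType) (X : finType) n (Z : freeLie K X) :
  (0 < n)%N -> free_homog n Z -> expand Z = 0 -> Z = 0.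
Proof.
move=> n0 Zn Z0; have := dynkin_expand Zn.
rewrite Z0 dynkin0 => /esym/eqP; rewrite scaler_eq0 pnatr_eq0.
by rewrite -[n == 0]negbK -lt0n n0 => /eqP.
Qed.

(** * Computing with integer combinations of words in three letters *)

Definition la : 'I_3 := @Ordinal 3 0 isT.
Definition lb : 'I_3 := @Ordinal 3 1 isT.
Definition lc : 'I_3 := @Ordinal 3 2 isT.
Definition letters := [:: la; lb; lc].

Lemma letter_ind (P : 'I_3 -> Prop) : P la -> P lb -> P lc -> forall x, P x.
Proof.
move=> Pa Pb Pc [[|[|[|//]]] lt3]; rewrite (bool_irrelevance lt3 isT) //.
Qed.

Lemma mem_letters x : x \in letters.
Proof. by elim/letter_ind: x. Qed.

Lemma sum_letters (V : nmodType) (F : 'I_3 -> V) :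
  \sum_x F x = F la + (F lb + F lc).
Proof.
rewrite 3!big_ord_recl big_ord0 addr0.
by congr (F _ + (F _ + F _)); apply: val_inj.
Qed.

Definition by_letter (T : Type) (ta tb tc : T) (x : 'I_3) : T :=
  match val x with 0 => ta | 1 => tb | _ => tc end.

(** A finite integer combination of words, stored as a ternary tree: a node
    holds the coefficient of the empty word and the left quotients by the three
    letters. *)
Inductive trie := Null | Node of Z & trie & trie & trie.

Definition const t := if t is Node k _ _ _ then k else Z0.
Definition child x t :=
  if t is Node _ ta tb tc then by_letter ta tb tc x else Null.
Fixpoint coef t (w : seq 'I_3) :=
  if w is x :: w' then coef (child x t) w' else const t.

Fixpoint tadd s t :=
  match s, t with
  | Null, _ => t
  | _, Null => s
  | Node k sa sb sc, Node l ta tb tc =>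
      Node (Z.add k l) (tadd sa ta) (tadd sb tb) (tadd sc tc)
  end.

Arguments tadd : simpl nomatch.

Fixpoint tscale k t :=
  if t is Node l ta tb tc then
    Node (Z.mul k l) (tscale k ta) (tscale k tb) (tscale k tc)
  else Null.

Fixpoint tmul s t :=
  if s is Node k sa sb sc then
    let st := Node Z0 (tmul sa t) (tmul sb t) (tmul sc t) in
    if Z.eqb k Z0 then st else tadd (tscale k t) st
  else Null.

Definition tsub s t := tadd s (tscale (Zneg xH) t).
Definition tbracket s t := tsub (tmul s t) (tmul t s).

Definition tcons x t :=
  by_letter (Node Z0 t Null Null) (Node Z0 Null t Null) (Node Z0 Null Null t) x.
Definition tword (w : seq 'I_3) := foldr tcons (Node (Zpos xH) Null Null Null) w.

Fixpoint tnull t :=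
  if t is Node k ta tb tc then [&& Z.eqb k Z0, tnull ta, tnull tb & tnull tc]
  else true.

Fixpoint tder i j t :=
  if t is Node _ ta tb tc then
    tadd (Node Z0 (tder i j ta) (tder i j tb) (tder i j tc))
         (tcons i (by_letter ta tb tc j))
  else Null.

(** The expansion of the Dynkin operator, computed without leaving series; see
    [expand_dynkin]. *)
Fixpoint tdynkin n t :=
  if n is n'.+1 then
    if t is Null then Null else
    let step x :=
      if n' is 0 then tscale (const (child x t)) (tword [:: x])
      else tbracket (tword [:: x]) (tdynkin n' (child x t)) in
    tadd (step la) (tadd (step lb) (step lc))
  else Null.

Section Evaluation.
Variable K : numFieldType.
Local Notation series := (series K 'I_3).
Implicit Types (s t : trie) (f : series).

Definition Zin (k : Z) : K := (int_of_Z k)%:~R.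

Lemma Zin0 : Zin Z0 = 0. Proof. by []. Qed.
Lemma ZinD k l : Zin (Z.add k l) = Zin k + Zin l.
Proof. by rewrite /Zin -intrD -(rmorphD int_of_Z). Qed.
Lemma ZinM k l : Zin (Z.mul k l) = Zin k * Zin l.
Proof. by rewrite /Zin -intrM -(rmorphM int_of_Z). Qed.
Lemma ZinB k l : Zin (Z.sub k l) = Zin k - Zin l.
Proof. by rewrite /Zin -intrB -(rmorphB int_of_Z). Qed.
Lemma ZinN1 : Zin (Zneg xH) = -1. Proof. by []. Qed.

Definition ev t : series := fun w => Zin (coef t w).

Lemma lder_ev x t : lder x (ev t) = ev (child x t).
Proof. by []. Qed.

Lemma coef_null w : coef Null w = Z0.
Proof. by elim: w. Qed.

Lemma ev_null : ev Null = 0.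
Proof. by apply: seriesP => w; rewrite /ev coef_null. Qed.

Lemma coef_tadd s t w : coef (tadd s t) w = Z.add (coef s w) (coef t w).
Proof.
elim: w s t => [|x w IH] [|k sa sb sc] [|l ta tb tc] //=;
  rewrite ?coef_null ?Z.add_0_r //.
by rewrite -IH; elim/letter_ind: x.
Qed.

Lemma ev_tadd s t : ev (tadd s t) = ev s + ev t.
Proof. by apply: seriesP => w; rewrite /ev coef_tadd ZinD. Qed.

Lemma ev_tscale k t : ev (tscale k t) = Zin k *: ev t.
Proof.
apply: seriesP => w; rewrite -[RHS]/(Zin k * ev t w) -ZinM; congr Zin.
elim: w t => [|x w IH] [|l ta tb tc] //=; rewrite ?coef_null ?Z.mul_0_r //.
by rewrite -IH; elim/letter_ind: x.
Qed.

Lemma ev_tsub s t : ev (tsub s t) = ev s - ev t.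
Proof. by rewrite ev_tadd ev_tscale ZinN1 scaleN1r. Qed.


Lemma ev_tmul s t : ev (tmul s t) = smul (ev s) (ev t).
Proof.
elim: s => [|k sa IHa sb IHb sc IHc]; first by rewrite ev_null smul0l.
set st := Node Z0 (tmul sa t) (tmul sb t) (tmul sc t).
have -> : ev (tmul (Node k sa sb sc) t) = Zin k *: ev t + ev st.
  rewrite /= -/st -ev_tscale -ev_tadd; case: Z.eqb_spec => // ->.
  by rewrite ev_tadd ev_tscale Zin0 scale0r add0r.
apply: series_eqP => [|x].
  by rewrite -[LHS]/(Zin k * ev t [::] + 0) addr0.
rewrite lder_smul [RHS]addrC -[LHS]/(Zin k *: lder x (ev t) + lder x (ev st)).
by congr (_ + _); rewrite lder_ev; elim/letter_ind: x.
Qed.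

Lemma ev_tbracket s t : ev (tbracket s t) = ⟦ev s, ev t⟧.
Proof. by rewrite ev_tsub !ev_tmul. Qed.

Lemma lder_tcons x y t : lder y (ev (tcons x t)) = (y == x)%:R *: ev t.
Proof.
rewrite lder_ev.
by elim/letter_ind: x; elim/letter_ind: y; rewrite /= ?ev_null ?scale0r ?scale1r.
Qed.

Lemma const_tcons x t : const (tcons x t) = Z0.
Proof. by elim/letter_ind: x. Qed.

Lemma coef_tword w u : coef (tword w) u = if u == w then (Zpos xH) else Z0.
Proof.
elim: w u => [|x w IH] [|y u] //=.
  by elim/letter_ind: y; rewrite /= coef_null.
  by rewrite const_tcons.
have -> : child y (tcons x (tword w)) = if y == x then tword w else Null.
  by elim/letter_ind: x; elim/letter_ind: y.
by rewrite eqseq_cons; case: eqP => //= _; rewrite coef_null.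
Qed.

Lemma ev_letter x : ev (tword [:: x]) = letter_series K x.
Proof.
by apply: seriesP => w; rewrite /ev coef_tword /letter_series; case: eqP.
Qed.

Lemma tnull_ev t : tnull t -> ev t = 0.
Proof.
elim: t => [_|k ta IHa tb IHb tc IHc /=]; first exact: ev_null.
case/and4P => /Z.eqb_spec-> /IHa a0 /IHb b0 /IHc c0.
by apply: series_eqP => [//|x]; rewrite lder_ev; elim/letter_ind: x.
Qed.

Lemma ev_tder i j t : ev (tder i j t) = sder (unit_fun K i j) (ev t).
Proof.
elim: t => [|k ta IHa tb IHb tc IHc]; first by rewrite ev_null sder0.
rewrite /= ev_tadd; apply: series_eqP => [|x].
  by rewrite -[LHS]/(0 + Zin (const _)) const_tcons addr0.
rewrite lder_sder_unit.
rewrite -[LHS]/(lder x (ev _) + lder x (ev (tcons _ _))) lder_tcons !lder_ev.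
by congr (_ + _); elim/letter_ind: x.
Qed.

Lemma expand_dynkin n t : expand (dynkin n (ev t)) = ev (tdynkin n t).
Proof.
elim: n t => [|n IH] t; first by rewrite expand0 ev_null.
case: t => [|k ta tb tc]; first by rewrite ev_null dynkin0 expand0.
set t := Node k ta tb tc.
pose step x := if n is 0 then (ev t [:: x] : K) *: free_gen K x
               else ⟦free_gen K x, dynkin n (lder x (ev t))⟧.
pose tstep x := if n is 0 then tscale (const (child x t)) (tword [:: x])
                else tbracket (tword [:: x]) (tdynkin n (child x t)).
have expand_step x : expand (step x) = ev (tstep x).
  rewrite {}/step {}/tstep; case: n IH => [|m] IH.
    by rewrite expandZ expand_gen ev_tscale ev_letter.
  by rewrite expand_bracket expand_gen lder_ev IH ev_tbracket ev_letter.
rewrite -[dynkin _ _]/(\sum_x step x) sum_letters 2!expandD !expand_step.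
by rewrite -[tdynkin _ _]/(tadd (tstep la) (tadd (tstep lb) (tstep lc))) 2!ev_tadd.
Qed.

End Evaluation.

(** * The four invariants as formal expressions *)

(** Formal bracket expressions, which can be evaluated both in the free Lie
    algebra and as tries. *)
Inductive lie_expr :=
| Gen of 'I_3
| Bracket of lie_expr & lie_expr
| Plus of lie_expr & lie_expr
| Minus of lie_expr & lie_expr
| Twice of lie_expr.

Fixpoint lie_value (K : numFieldType) (e : lie_expr) : freeLie K 'I_3 :=
  match e with
  | Gen x => free_gen K x
  | Bracket e1 e2 => ⟦lie_value K e1, lie_value K e2⟧
  | Plus e1 e2 => lie_value K e1 + lie_value K e2
  | Minus e1 e2 => lie_value K e1 - lie_value K e2
  | Twice e1 => 2%:R *: lie_value K e1
  end.

Fixpoint trie_value e :=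
  match e with
  | Gen x => tword [:: x]
  | Bracket e1 e2 => tbracket (trie_value e1) (trie_value e2)
  | Plus e1 e2 => tadd (trie_value e1) (trie_value e2)
  | Minus e1 e2 => tsub (trie_value e1) (trie_value e2)
  | Twice e1 => tscale (Zpos 2) (trie_value e1)
  end.

Fixpoint degree e : nat :=
  match e with
  | Gen _ => 1
  | Bracket e1 e2 => (degree e1 + degree e2)%N
  | Plus e1 _ | Minus e1 _ | Twice e1 => degree e1
  end.

Fixpoint graded e :=
  match e with
  | Gen _ => true
  | Bracket e1 e2 => graded e1 && graded e2
  | Plus e1 e2 | Minus e1 e2 => [&& degree e1 == degree e2, graded e1 & graded e2]
  | Twice e1 => graded e1
  end.

Ltac reify u :=
  lazymatch u with
  | free_gen _ ?x => constr:(Gen x)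
  | lie_bracket ?u ?v =>
      let e := reify u in let f := reify v in constr:(Bracket e f)
  | GRing.add ?u (GRing.opp ?v) =>
      let e := reify u in let f := reify v in constr:(Minus e f)
  | GRing.add ?u ?v =>
      let e := reify u in let f := reify v in constr:(Plus e f)
  | GRing.scale _ ?u => let e := reify u in constr:(Twice e)
  end.

(** The expressions do not depend on the field; the rational numbers only serve
    to have closed terms to read them from. *)
Definition expr1 : lie_expr :=
  ltac:(let u := eval unfold I9_1 in (I9_1 rat) in let e := reify u in exact e).
Definition expr2 : lie_expr :=
  ltac:(let u := eval unfold I9_2 in (I9_2 rat) in let e := reify u in exact e).
Definition expr3 : lie_expr :=
  ltac:(let u := eval unfold I9_3 in (I9_3 rat) in let e := reify u in exact e).
Definition expr4 : lie_expr :=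
  ltac:(let u := eval unfold I9_4 in (I9_4 rat) in let e := reify u in exact e).

Section LieExpr.
Variable K : numFieldType.

Lemma expand_lie_value e : expand (lie_value K e) = ev K (trie_value e).
Proof.
elim: e => [x|e1 IH1 e2 IH2|e1 IH1 e2 IH2|e1 IH1 e2 IH2|e IH].
- by rewrite [LHS]expand_gen -ev_letter.
- by rewrite /= ev_tbracket -IH1 -IH2 expand_bracket.
- by rewrite /= ev_tadd -IH1 -IH2 expandD.
- by rewrite /= ev_tsub -IH1 -IH2 expandB.
- by rewrite /= ev_tscale -IH expandZ.
Qed.

Lemma homog_lie_value e : graded e -> free_homog (degree e) (lie_value K e).
Proof.
elim: e => [x|e1 IH1 e2 IH2|e1 IH1 e2 IH2|e1 IH1 e2 IH2|e IH] /=.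
- by move=> _; exact: free_homog_gen.
- by case/andP=> /IH1 ? /IH2 ?; exact: free_homog_bracket.
- case/and3P=> /eqP e12 /IH1 h1 /IH2; rewrite -e12 => h2.
  exact: free_homogD.
- case/and3P=> /eqP e12 /IH1 h1 /IH2; rewrite -e12 => h2.
  by apply: free_homogD => //; rewrite -scaleN1r; exact: free_homogZ.
- by move/IH; exact: free_homogZ.
Qed.
End LieExpr.


(** * Ballot words, products of determinants and linear relations *)

(** The factor 3 is the weight: E_ii multiplies a word by its number of
    letters [i], which is 3 in an invariant of degree 9. *)
Definition invariant_trie t :=
  all (fun i => all (fun j =>
    tnull (tsub (tder i j t) (if i == j then tscale (Zpos 3) t else Null)))
    letters) letters.

(** Meaningful for [n = a + b + c], when these are all the words with [a], [b]
    and [c] occurrences of the respective letters. *)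
Fixpoint words n a b c : seq (seq 'I_3) :=
  if n is n'.+1 then
    (if a is a'.+1 then map (cons la) (words n' a' b c) else [::]) ++
    (if b is b'.+1 then map (cons lb) (words n' a b' c) else [::]) ++
    (if c is c'.+1 then map (cons lc) (words n' a b c') else [::])
  else [:: [::]].

Lemma mem_words w :
  w \in words (size w) (count_mem la w) (count_mem lb w) (count_mem lc w).
Proof.
elim: w => // x w IH; rewrite [size _]/=.
by elim/letter_ind: x; rewrite /= !mem_cat (map_f _ IH) ?orbT.
Qed.

Definition ballot (w : seq 'I_3) :=
  all (fun k => let u := take k w in
         (count_mem lc u <= count_mem lb u <= count_mem la u)%N)
      (iota 0 (size w).+1).
(** There are 42 of these, one for each standard tableau of shape 3 x 3. *)
Definition ballots := [seq w <- words 9 3 3 3 | ballot w].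

(** A ballot word [u] records a standard tableau by its columns: position [k]
    lies in the column [u_k].  Its row is then the number of earlier entries of
    the same column, and the rows form another ballot word. *)
Definition row_word (u : seq 'I_3) : seq 'I_3 :=
  mkseq (fun k => nth lc letters (count_mem (nth la u k) (take k u))) (size u).

(** The product of three determinants, where the determinant number [k] involves
    the positions at which [u] has the letter [k].  Positions are filled from
    left to right; [used] lists the letters already placed in each column, so
    that the sign of a new letter is given by its inversions with them. *)
Fixpoint det_product_from (used : seq (seq 'I_3)) (u : seq 'I_3) : trie :=
  if u is k :: u' then
    let col := nth [::] used k in
    let branch (x : 'I_3) := if x \in col then Null else
      let t := det_product_from (set_nth [::] used k (x :: col)) u' in
      if odd (count (fun y : 'I_3 => x < y)%N col) then tscale (Zneg xH) t else t in
    Node Z0 (branch la) (branch lb) (branch lc)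
  else Node (Zpos xH) Null Null Null.
Definition det_product := det_product_from [::].

(** The matrix of the coefficients of the products [det_product u'] at the words
    [row_word u] is unitriangular in the order of the list. *)
Fixpoint unitriangular (us : seq (seq 'I_3)) :=
  if us is u :: us' then
    [&& Z.eqb (coef (det_product u) (row_word u)) (Zpos xH),
        all (fun u' => Z.eqb (coef (det_product u') (row_word u)) Z0) us'
      & unitriangular us']
  else true.

(** For [i != j], the words whose image under E_ij contains [u]; see
    [sder_flips]. *)
Fixpoint flips (i j : 'I_3) (u : seq 'I_3) : seq (seq 'I_3) :=
  if u is x :: u' then
    (if x == i then [:: j :: u'] else [::]) ++ map (cons x) (flips i j u')
  else [::].

(** Each list consists of words at which the coefficients of an invariant sum to
    0.  The first kind expresses that E_ab kills the invariant, the second one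
    that exchanging two letters changes its sign (three times, once for each
    occurrence of a letter). *)
Definition relations : seq (seq (seq 'I_3)) :=
  [seq flips la lb u | u <- words 9 4 2 3] ++
  flatten [seq [:: [:: w; map (swap la lb) w]; [:: w; map (swap lb lc) w]]
          | w <- words 9 3 3 3].

(** A trie also serves as a set of words, namely its support. *)
Definition mem_trie t w := ~~ Z.eqb (coef t w) Z0.
(** In a relation with only one word outside a set on which the coefficients
    vanish, the coefficient of that word vanishes as well. *)
Definition propagate known rel :=
  if [seq w <- rel | ~~ mem_trie known w] is [:: w] then tadd known (tword w)
  else known.



Definition known0 :=
  foldr (fun w t => tadd t (tword w)) Null (map row_word ballots).

(* Six sweeps through the relations reach all the words. *)
Definition known :=
  iter 6 (fun t => foldl propagate t relations) known0.

Lemma known_complete : all (mem_trie known) (words 9 3 3 3).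
Proof. by vm_compute. Qed.

Lemma det_products_unitriangular : unitriangular (rev ballots).
Proof. by vm_compute. Qed.

Lemma det_products_invariant :
  all (fun u => invariant_trie (det_product u)) ballots.
Proof. by vm_compute. Qed.

Definition exprs := [:: expr1; expr2; expr3; expr4].

Lemma exprs_graded : all (fun e => graded e && (degree e == 9)) exprs.
Proof. by vm_compute. Qed.

Lemma exprs_invariant : all (fun e => invariant_trie (trie_value e)) exprs.
Proof. by vm_compute. Qed.

(** Four linear forms, differences of two coefficients, that are dual to the
    four invariants.  Both I_9^(1) and I_9^(2) have coefficient 1 at the first
    word of the first pair, whence its second word; the empty words of the
    other pairs contribute 0. *)
Definition test_words : seq (seq 'I_3 * seq 'I_3) :=
  [:: ([:: la; la; lc; lb; lc; lc; lb; lb; la],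
       [:: la; lb; lb; lc; la; la; lc; lc; lb]);
      ([:: la; lb; lb; lc; la; la; lc; lc; lb], [::]);
      ([:: la; la; lb; lb; la; lc; lc; lb; lc], [::]);
      ([:: la; la; la; lb; lc; lc; lb; lb; lc], [::])].

Definition coords t := [seq Z.sub (coef t p.1) (coef t p.2) | p <- test_words].

Lemma coords_exprs :
  all (fun i => all (fun j =>
    Z.eqb (nth Z0 (coords (trie_value (nth expr1 exprs j))) i)
          (if i == j then Zpos xH else Z0)) (iota 0 4)) (iota 0 4).
Proof. by vm_compute. Qed.

Definition tcomb (cs : seq Z) (ts : seq trie) :=
  foldr (fun p t => tadd (tscale p.1 p.2) t) Null (zip cs ts).

Lemma dynkin_det_products :
  let ts := map trie_value exprs in
  all (fun u => let t := tdynkin 9 (det_product u) in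
                tnull (tsub t (tcomb (coords t) ts))) ballots.
Proof. by vm_compute. Qed.

(* The enumerations were evaluated above; from here on only their properties
   matter, and unfolding them would be costly. *)
#[local] Strategy opaque [words ballots relations known0 det_product].

(** * The space of invariants of degree 9 *)

Section Assembly.
Variable K : numFieldType.
Local Notation L := (freeLie K 'I_3).
Local Notation series := (series K 'I_3).
Implicit Types (f g : series) (t : trie) (Z : L) (D : 'M[K]_3).

(** Invariance under sl_3 of a series of degree 9, together with its weight, as
    nine equations which make sense for any series. *)
Definition sl3_invariant f :=
  forall i j, sder (unit_fun K i j) f = if i == j then 3%:R *: f else 0.

Lemma sl3_invariant_linear k f g :
  sl3_invariant f -> sl3_invariant g -> sl3_invariant (k *: f + g).
Proof.
move=> fI gI i j; rewrite sder_linear fI gI.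
case: eqP => _; last by rewrite scaler0 addr0.
by rewrite scalerDr !scalerA mulrC.
Qed.

Lemma invariant_trieP t : invariant_trie t -> sl3_invariant (ev K t).
Proof.
move=> /allP tI i j.
have /allP/(_ j (mem_letters j))/(tnull_ev K) := tI i (mem_letters i).
rewrite ev_tsub ev_tder => /eqP; rewrite subr_eq0 => /eqP ->.
by case: eqP => _; rewrite ?ev_null // ev_tscale.
Qed.

Lemma sl3_act_invariant n D Z : (0 < n)%N -> free_homog n Z ->
  sl3_invariant (expand Z) -> sl3 D -> sl3_act D Z = 0.
Proof.
move=> n0 Zn ZI trD.
apply: (expand_inj0 n0 (free_homog_der (fun i j => D i j) Zn)).
rewrite expand_free_der sder_sum_unit.
rewrite (eq_bigr (fun i => D i i *: (3%:R *: expand Z))) => [|i _].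
  by rewrite -scaler_suml -/(mxtrace D) trD scale0r.
rewrite (bigD1 i) //= big1 ?addr0 => [|j /negPf ij]; rewrite ZI ?eqxx //.
by rewrite eq_sym ij scaler0.
Qed.

Lemma sder_matrixB (M N : 'I_3 -> 'I_3 -> K) f :
  sder (fun x y => M x y - N x y) f = sder M f - sder N f.
Proof.
rewrite sder_sum_unit (sder_sum_unit M) (sder_sum_unit N).
rewrite -sumrB; apply: eq_bigr => i _; rewrite -sumrB; apply: eq_bigr => j _.
exact: scalerBl.
Qed.

Lemma size_letters (w : seq 'I_3) :
  size w = (count_mem la w + (count_mem lb w + count_mem lc w))%N.
Proof.
elim: w => //= x w ->.
by elim/letter_ind: x; rewrite /= ?add0n ?add1n ?addSn ?addnS.
Qed.

(** The differences of the E_ii have trace 0, so the three E_ii act in the same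
    way on an invariant; their sum is the degree 9, and each of them acts as
    3. *)
Lemma lie_invariant_expand Z : lie_invariant 9 Z -> sl3_invariant (expand Z).
Proof.
case=> Z9 ZI; pose E i j : 'M[K]_3 := delta_mx i j.
have EI (M : 'M[K]_3) : sl3 M -> sder (fun i j => M i j) (expand Z) = 0.
  by move=> /ZI ZM; rewrite -expand_free_der [X in expand X]ZM expand0.
have trE i j : \tr (E i j) = (i == j)%:R.
  rewrite /mxtrace (bigD1 i) //= big1 ?addr0 => [|l /negPf li].
    by rewrite mxE eqxx.
  by rewrite mxE li.
have unitE i j : (fun x y => E i j x y) = unit_fun K i j.
  by apply: funext => x; apply: funext => y; rewrite mxE.
have off i j : i != j -> sder (unit_fun K i j) (expand Z) = 0.
  by move=> /negPf ij; rewrite -unitE; apply: EI; rewrite /sl3 trE ij.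
have diag i j : sder (unit_fun K i i) (expand Z) = sder (unit_fun K j j) (expand Z).
  apply/eqP; rewrite -subr_eq0 -sder_matrixB -!unitE; apply/eqP.
  have := EI (E i i - E j j); rewrite /sl3 raddfB /= !trE !eqxx subrr => /(_ erefl) <-.
  by congr sder; apply: funext => x; apply: funext => y; rewrite !mxE.
move=> i j; case: (eqVneq i j) => [<-|/off //].
apply: seriesP => w; rewrite -[RHS]/(3%:R * expand Z w) sder_unit_diag.
have [w9|/(expand_homogeneous Z9) ->] := eqVneq (size w) 9; last by rewrite !mulr0.
have count_eq j' : (count_mem j' w)%:R * expand Z w = (count_mem i w)%:R * expand Z w.
  by rewrite -!sder_unit_diag (diag j' i).
apply: (@mulfI _ 3%:R); first by rewrite pnatr_eq0.
rewrite [RHS]mulrA -natrM -[(3 * 3)%N]w9 size_letters !natrD !mulrDl !count_eq.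
by ring.
Qed.

Lemma sl3_invariant_content f x w :
  sl3_invariant f -> count_mem x w != 3 -> f w = 0.
Proof.
move=> fI x3; have := sder_unit_diag x f w; rewrite fI eqxx => /eqP.
rewrite -[X in X == _]/(3%:R * f w) -subr_eq0 -mulrBl mulf_eq0 subr_eq0 eqr_nat.
by rewrite eq_sym (negPf x3) => /eqP.
Qed.

Lemma sder_flips i j f u :
  sder (unit_fun K i j) f u = \sum_(w <- flips i j u) f w.
Proof.
elim: u f => [|x u IH] f; first by rewrite big_nil.
rewrite -[LHS]/(lder x (sder (unit_fun K i j) f) u) lder_sder_unit.
rewrite -[LHS]/(sder _ (lder x f) u + (x == i)%:R * f (j :: u)) IH.
rewrite /= big_cat big_map addrC; congr (_ + _).
by case: eqP => _; rewrite ?big_seq1 ?big_nil ?mul1r ?mul0r.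
Qed.

(** The sign of [swap_sign] is that of an odd power, since only words with three
    letters [j] occur. *)
Lemma sl3_invariant_swap i j f w : i != j -> sl3_invariant f ->
  f w + f (map (swap i j) w) = 0.
Proof.
move=> ij fI; have ji : j != i by rewrite eq_sym.
have := fI i j; rewrite (negPf ij) => Eij; have := fI j i; rewrite (negPf ji) => Eji.
have fw := swap_sign ij w Eij Eji.
have [w3|/(sl3_invariant_content fI) w0] := eqVneq (count_mem j w) 3.
  by rewrite fw w3 -signr_odd mulN1r addNr.
by move: fw; rewrite w0 add0r => /esym/eqP; rewrite mulf_eq0 signr_eq0 => /eqP.
Qed.

Lemma relations_hold f r :
  sl3_invariant f -> r \in relations -> \sum_(w <- r) f w = 0.
Proof.
move=> fI; rewrite mem_cat => /orP[/mapP[u _ ->]|/flattenP[s /mapP[w _ ->]]].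
  by rewrite -sder_flips fI.
by rewrite !inE => /orP[]/eqP->; rewrite big_cons big_seq1 sl3_invariant_swap.
Qed.

Definition vanishes_on f t := forall w, mem_trie t w -> f w = 0.

Lemma vanishes_tadd f s w : vanishes_on f s -> f w = 0 ->
  vanishes_on f (tadd s (tword w)).
Proof.
move=> fs fw u; rewrite /mem_trie coef_tadd coef_tword.
by case: eqP => [-> //|_]; rewrite Z.add_0_r => /fs.
Qed.

Lemma vanishes_propagate f t r :
  \sum_(w <- r) f w = 0 -> vanishes_on f t -> vanishes_on f (propagate t r).
Proof.
move=> r0 ft; rewrite /propagate; case E: [seq _ <- _ | _] => [|w [|//]] //.
apply: vanishes_tadd => //; move: r0; rewrite (bigID (mem_trie t)) /= big1 => [|u /ft //].
by rewrite add0r -big_filter E big_seq1.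
Qed.

Lemma vanishes_foldl f rs t : {in rs, forall r, \sum_(w <- r) f w = 0} ->
  vanishes_on f t -> vanishes_on f (foldl propagate t rs).
Proof.
elim: rs t => //= r rs IH t rs0 ft; apply: IH => [r' r'rs|].
  by apply: rs0; rewrite inE r'rs orbT.
by apply: vanishes_propagate => //; apply: rs0; rewrite inE eqxx.
Qed.

Lemma vanishes_iter f rs n t : {in rs, forall r, \sum_(w <- r) f w = 0} ->
  vanishes_on f t ->
  vanishes_on f (iter n (fun t => foldl propagate t rs) t).
Proof. by move=> rs0 ft; elim: n => //= n IH; exact: vanishes_foldl. Qed.

Lemma vanishes_words f (ws : seq (seq 'I_3)) : {in ws, forall w, f w = 0} ->
  vanishes_on f (foldr (fun w t => tadd t (tword w)) Null ws).
Proof.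
elim: ws => [_ w|w ws IH ws0] /=; first by rewrite /mem_trie coef_null.
apply: vanishes_tadd; last by apply: ws0; rewrite inE eqxx.
by apply: IH => u u_ws; apply: ws0; rewrite inE u_ws orbT.
Qed.

(** The set of words at which f vanishes contains the ballot words and is stable
    under [propagate], so it contains [known]. *)
Lemma sl3_invariant_eq0 f : sl3_invariant f ->
  {in ballots, forall u, f (row_word u) = 0} -> f = 0.
Proof.
move=> fI f0; apply: seriesP => w.
have [a3|/(sl3_invariant_content fI) //] := eqVneq (count_mem la w) 3.
have [b3|/(sl3_invariant_content fI) //] := eqVneq (count_mem lb w) 3.
have [c3|/(sl3_invariant_content fI) //] := eqVneq (count_mem lc w) 3.
have := mem_words w; rewrite size_letters a3 b3 c3.
move=> /(allP known_complete); rewrite /known.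
apply: vanishes_iter => [r|]; first exact: relations_hold.
by apply: vanishes_words => _ /mapP[u uP ->]; exact: f0.
Qed.

(** Forward substitution.  [P] stands for any linear subspace; the induction
    replaces it by its intersection with the kernel of the first coefficient,
    which contains the remaining products by unitriangularity. *)
Lemma unitriangular_solve (P : series -> Prop) us f :
    P 0 -> (forall k g h, P g -> P h -> P (k *: g + h)) ->
    unitriangular us -> {in us, forall u, P (ev K (det_product u))} ->
  exists2 g, P g & {in us, forall u, f (row_word u) = g (row_word u)}.
Proof.
elim: us P f => [|u us IH] P f P0 PL /=; first by exists 0.
set t := det_product u; set w := row_word u.
case/and3P=> /Z.eqb_spec tw /allP usw us1 Ps.
pose Q g := P g /\ g w = 0.
have [||v v_us|g [Pg gw] fg] := IH Q (f - f w *: ev K t) _ _ us1.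
- by split.
- move=> k g h [Pg gw] [Ph hw]; split; first exact: PL.
  by rewrite -[LHS]/(k * g w + h w) gw hw mulr0 addr0.
- split; first by apply: Ps; rewrite inE v_us orbT.
  by rewrite /ev; have /Z.eqb_spec -> := usw _ v_us.
exists (f w *: ev K t + g); first by apply: PL => //; apply: Ps; rewrite inE eqxx.
move=> v; rewrite inE => /predU1P[->|/fg].
  by rewrite -[RHS]/(f w * Zin K (coef t w) + g w) tw gw mulr1 addr0.
set x := row_word v => /eqP.
rewrite -[X in X == _]/(f x - f w * ev K t x) subr_eq => /eqP ->.
by rewrite addrC.
Qed.

Definition I9 : 4.-tuple L := [tuple I9_1 K; I9_2 K; I9_3 K; I9_4 K].

Lemma tnth_I9 i : tnth I9 i = lie_value K (nth expr1 exprs i).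
Proof.
by rewrite (tnth_nth 0); case: i => [[|[|[|[|//]]]]].
Qed.

Definition in_span Z := exists c : 'I_4 -> K, Z = \sum_i c i *: tnth I9 i.

Lemma in_span_linear k Y Z : in_span Y -> in_span Z -> in_span (k *: Y + Z).
Proof.
case=> c -> [d ->]; exists (fun i => k * c i + d i).
rewrite scaler_sumr -big_split; apply: eq_bigr => i _ /=.
by rewrite scalerDl scalerA.
Qed.

Lemma in_span0 : in_span 0.
Proof. by exists (fun _ => 0); rewrite big1 // => i _; rewrite scale0r. Qed.

Lemma I9_invariant i : lie_invariant 9 (tnth I9 i).
Proof.
have /andP[/(homog_lie_value K) + /eqP i9] :=
  all_nthP expr1 exprs_graded _ (ltn_ord i).
rewrite i9 -tnth_I9 => Ii9; split=> // D; apply: (sl3_act_invariant (n := 9)) => //.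
rewrite tnth_I9 expand_lie_value; apply: invariant_trieP.
exact: (all_nthP expr1 exprs_invariant _ (ltn_ord i)).
Qed.

Lemma expand_sum_I9 (c : 'I_4 -> K) : expand (\sum_i c i *: tnth I9 i)
  = \sum_(i < 4) c i *: ev K (trie_value (nth expr1 exprs i)).
Proof.
elim/big_rec2: _ => [|i f Z _ <-]; first exact: expand0.
by rewrite expand_linear tnth_I9 expand_lie_value.
Qed.

Lemma free_homog_sum_I9 (c : 'I_4 -> K) : free_homog 9 (\sum_i c i *: tnth I9 i).
Proof.
elim/big_rec: _ => [|i Z _ Z9]; first exact: free_homog0.
apply: free_homogD => //; apply: free_homogZ; exact: (I9_invariant i).1.
Qed.

Lemma in_span_invariant Z : in_span Z -> lie_invariant 9 Z.
Proof.
case=> c ->; split=> [|D trD]; first exact: free_homog_sum_I9.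
apply: (sl3_act_invariant (n := 9)) => //; first exact: free_homog_sum_I9.
rewrite expand_sum_I9; elim/big_rec: _ => [|i f _ fI].
  by move=> i j; rewrite sder0 scaler0; case: eqP.
apply: sl3_invariant_linear => //; apply: invariant_trieP.
exact: (all_nthP expr1 exprs_invariant _ (ltn_ord i)).
Qed.

Lemma ev_tcomb cs : size cs = 4 ->
  ev K (tcomb cs (map trie_value exprs)) =
  \sum_(i < 4) Zin K (nth Z0 cs i) *: ev K (trie_value (nth expr1 exprs i)).
Proof.
move: cs => [|c1 [|c2 [|c3 [|c4 [|//]]]]] // _.
by rewrite 4!ev_tadd ev_null !ev_tscale 4!big_ord_recl big_ord0.
Qed.

(** The coordinates can only be given by the forms of [test_words], and the
    computation confirms that they work. *)
Lemma dynkin_det_in_span u :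
  u \in ballots -> in_span (dynkin 9 (ev K (det_product u))).
Proof.
move=> /(allP dynkin_det_products)/(tnull_ev K).
rewrite ev_tsub ev_tcomb // -expand_dynkin.
set cs := coords _ => /eqP cs0.
exists (fun i => Zin K (nth Z0 cs i)); apply/eqP; rewrite -subr_eq0; apply/eqP.
apply: (@expand_inj0 _ _ 9) => //; last by rewrite expandB expand_sum_I9; apply/eqP.
apply: free_homogD; first exact: dynkin_homog.
by rewrite -scaleN1r; apply: free_homogZ; exact: free_homog_sum_I9.
Qed.

(** The combination [g] of products of determinants is only known through the
    two properties it inherits from them: it is invariant, hence equal to the
    expansion of Z, and its Dynkin image, which is 9 Z, lies in the span. *)
Lemma lie_invariant_in_span Z : lie_invariant 9 Z -> in_span Z.
Proof.
move=> ZI; have fI := lie_invariant_expand ZI; set f := expand Z in fI.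
pose P g := sl3_invariant g /\ in_span (dynkin 9 g).
have [|k g h [gI gS] [hI hS]|u|g [gI gS] fg] :=
  @unitriangular_solve P _ f _ _ det_products_unitriangular.
- split; last by rewrite dynkin0; exact: in_span0.
  by move=> i j; rewrite sder0 scaler0; case: eqP.
- split; first exact: sl3_invariant_linear.
  by rewrite dynkin_linear; exact: in_span_linear.
- rewrite mem_rev => uP; split; last exact: dynkin_det_in_span.
  exact/invariant_trieP/(allP det_products_invariant).
have fgE : f = g.
  apply/eqP; rewrite -subr_eq0; apply/eqP; apply: sl3_invariant_eq0 => [|u uP].
    by rewrite addrC -scaleN1r; exact: sl3_invariant_linear.
  have fgu : f (row_word u) = g (row_word u) by apply: fg; rewrite mem_rev.
  by rewrite -[LHS]/(f (row_word u) - g (row_word u)) fgu subrr.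
have := dynkin_expand ZI.1; rewrite -/f fgE => Z9.
have -> : Z = (9%:R^-1 : K) *: dynkin 9 g + 0.
  by rewrite addr0 Z9 scalerA mulVf ?scale1r // pnatr_eq0.
by apply: in_span_linear => //; exact: in_span0.
Qed.

Lemma I9_free (c : 'I_4 -> K) :
  \sum_i c i *: tnth I9 i = 0 -> forall i, c i = 0.
Proof.
move=> c0 i; have := expand_sum_I9 c; rewrite c0 expand0 => /esym f0.
set p := nth ([::], [::]) test_words i.
have dual (j : 'I_4) :
    let t := trie_value (nth expr1 exprs j) in ev K t p.1 - ev K t p.2 = (i == j)%:R.
  move=> t; rewrite /ev -ZinB.
  rewrite -(nth_map _ Z0 (fun p => Z.sub (coef t p.1) (coef t p.2))) //.
  have ord_iota (l : 'I_4) : (l : nat) \in iota 0 4 by rewrite mem_iota ltn_ord.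
  have /Z.eqb_spec -> := allP (allP coords_exprs _ (ord_iota i)) _ (ord_iota j).
  by rewrite -val_eqE; case: eqP.
have f0w w : \sum_(j < 4) c j * ev K (trie_value (nth expr1 exprs j)) w = 0.
  by rewrite -[RHS](congr1 (fun f : series => f w) f0) series_sumE.
have := congr2 (fun x y => x - y) (f0w p.1) (f0w p.2).
rewrite /= subrr -sumrB (bigD1 i) //= -mulrBr dual eqxx mulr1 big1 ?addr0 // => j ji.
by rewrite -mulrBr dual eq_sym (negPf ji) mulr0.
Qed.

Lemma I9_is_basis : is_basis (lie_invariant 9) I9.
Proof.
split=> [Z|]; last exact: I9_free.
by split=> [/lie_invariant_in_span|/in_span_invariant].
Qed.
End Assembly.

Theorem theorem28 (R : realType) :
  has_dim (lie_invariant (K := R[i]) 9) 4 /\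
  is_basis (lie_invariant (K := R[i]) 9)
    [tuple I9_1 R[i]; I9_2 R[i]; I9_3 R[i]; I9_4 R[i]].
Proof.
split; last exact: I9_is_basis.
by eexists; exact: I9_is_basis.
Qed.
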